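(* Let $F_2$ be the free group of rank $2$. There exists an algorithm that decides, for any two given elements $u, v \in F_2$, whether or not $u$ and $v$ are translation equivalent in $F_2$.
   Context: For $w \in F_2$ (with a fixed free basis), the cyclic length $\|w\|$ is the length of a cyclically reduced word conjugate to $w$. Two elements $u, v \in F_2$ are called translation equivalent in $F_2$ if $\|\phi(u)\| = \|\phi(v)\|$ for every automorphism $\phi$ of $F_2$. *)

(* Defs.v *)
From mathcomp Require Import all_boot.
Set Implicit Arguments. Unset Strict Implicit. Unset Printing Implicit Defensive.

(* A letter is (g, e): g = false for a, true for b; e = true means inverse. *)
Definition letter := (bool * bool)%type.
Definition linv (l : letter) : letter := (l.1, ~~ l.2).

Definition reduced (w : seq letter) : bool := sorted (fun x y => y != linv x) w.

Definition push (l : letter) (w : seq letter) : seq letter :=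
  match w with
  | x :: w' => if x == linv l then w' else l :: w
  | [::] => [:: l]
  end.
Definition reduce (w : seq letter) : seq letter := foldr push [::] w.

(* Elements of F_2 are represented by their unique freely reduced words. *)
Definition winv (w : seq letter) : seq letter := rev (map linv w).

(* The endomorphism of F_2 sending a |-> x, b |-> y (every endomorphism of the
   free group F_2 is of this form, by the universal property). *)
Definition img (x y : seq letter) (l : letter) : seq letter :=
  let base := if l.1 then y else x in if l.2 then winv base else base.
Definition endo (x y : seq letter) (w : seq letter) : seq letter :=
  reduce (flatten (map (img x y) w)).

Definition is_aut (x y : seq letter) : Prop :=
  (forall w1 w2, reduced w1 -> reduced w2 -> endo x y w1 = endo x y w2 -> w1 = w2)
  /\ (forall w, reduced w -> exists2 w', reduced w' & endo x y w' = w).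

Fixpoint cred_aux (n : nat) (w : seq letter) : seq letter :=
  match n with
  | 0 => w
  | n'.+1 =>
    match w with
    | x :: w' => if (w' != [::]) && (last x w' == linv x)
                 then cred_aux n' (behead (belast x w')) else w
    | [::] => w
    end
  end.
Definition cyc_reduce (w : seq letter) : seq letter := cred_aux (size w) w.

Definition cyclen (w : seq letter) : nat := size (cyc_reduce w).

Definition translation_equivalent (u v : seq letter) : Prop :=
  forall x y, is_aut x y -> cyclen (endo x y u) = cyclen (endo x y v).

Inductive prf : Type :=
| PZero : prf
| PSucc : prf
| PProj : nat -> prf
| PComp : prf -> seq prf -> prf
| PRec  : prf -> prf -> prf
| PMu   : prf -> prf.

Inductive eval : prf -> seq nat -> nat -> Prop :=
| ev_zero xs : eval PZero xs 0
| ev_succ xs : eval PSucc xs (head 0 xs).+1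
| ev_proj i xs : eval (PProj i) xs (nth 0 xs i)
| ev_comp f gs xs ys z : evals gs xs ys -> eval f ys z -> eval (PComp f gs) xs z
| ev_rec0 f g xs z : eval f xs z -> eval (PRec f g) (0 :: xs) z
| ev_recS f g n xs y z :
    eval (PRec f g) (n :: xs) y -> eval g (n :: y :: xs) z ->
    eval (PRec f g) (n.+1 :: xs) z
| ev_mu f xs n : eval f (n :: xs) 0 ->
    (forall m, m < n -> exists k, eval f (m :: xs) k.+1) -> eval (PMu f) xs n
with evals : seq prf -> seq nat -> seq nat -> Prop :=
| evs_nil xs : evals [::] xs [::]
| evs_cons g gs xs y ys : eval g xs y -> evals gs xs ys -> evals (g :: gs) xs (y :: ys).

(* encoding of letters and words as natural numbers (base 5, digits 1..4; injective) *)
Definition enc_letter (l : letter) : nat := (l.1 : nat) * 2 + (l.2 : nat).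
Fixpoint enc (w : seq letter) : nat :=
  match w with
  | [::] => 0
  | l :: w' => (enc_letter l).+1 + 5 * enc w'
  end.

(* Main.v *)
Require Import Defs.
From mathcomp Require Import all_boot zify.
From Stdlib Require Import Setoid Morphisms.
Set Implicit Arguments. Unset Strict Implicit. Unset Printing Implicit Defensive.

(** Up to inner automorphisms and a final signed permutation of the basis, which
do not affect cyclic length, every automorphism of [F_2] is a signed permutation
followed by a positive word in the two stretchings [g -> g g'], [g' -> g'], where
[g], [g'] are the two generators (Nielsen reduction).  A stretching acts on
cyclically reduced words without cancellation: it keeps the letters on [g], drops
those on [g'], and inserts a letter on [g'] between consecutive letters of the
same sign.  Hence the lengths along a positive word are governed by the letter
counts of the initial word and by the numbers of cyclic sign changes.  The latter
depend only on the cyclic sequence of maximal constant-sign runs, where a run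
containing both generators stays so forever and its length can be forgotten.  A
stretching either leaves this finite data unchanged or decreases an integer
potential bounded by three times the length, so positive words of length linear in
[|u| + |v|] detect any difference between the cyclic lengths of [u] and [v]. *)

(** * Free reduction *)

Arguments reduced : simpl never.
Arguments winv : simpl never.

Notation word := (seq letter) (only parsing).

Definition weq (u v : word) : Prop := reduce u = reduce v.
Infix "=F" := weq (at level 70).

#[global] Instance weq_equiv : Equivalence weq.
Proof.
split=> [u // | u v e | u v w e1 e2]; first exact: esym e.
exact: etrans e1 e2.
Qed.

Lemma linvK : involutive linv.
Proof. by case=> g e; rewrite /linv negbK. Qed.

Lemma linv_inj : injective linv.
Proof. exact: inv_inj linvK. Qed.

Lemma linv_neq l : (linv l == l) = false.
Proof. by case: l => [[] []]. Qed.

Lemma reduced_cons2 c d w :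
  reduced (c :: d :: w) = (d != linv c) && reduced (d :: w).
Proof. by []. Qed.

Lemma reduced_behead c w : reduced (c :: w) -> reduced w.
Proof. by case: w => [//|d w]; rewrite reduced_cons2 => /andP[]. Qed.

Lemma reduced_catl u v : reduced (u ++ v) -> reduced u.
Proof. by move/cat_sorted2=> []. Qed.

Lemma reduced_catr u v : reduced (u ++ v) -> reduced v.
Proof. by move/cat_sorted2=> []. Qed.

(** Reducedness concerns adjacent letters only, and the nonempty overlap [c] keeps every adjacent
    pair inside [u ++ c] or [c ++ v]. *)
Lemma reduced_glue u c v : c != [::] ->
  reduced (u ++ c) -> reduced (c ++ v) -> reduced (u ++ c ++ v).
Proof.
case: c => [//|x c] _; rewrite /reduced !(sorted_cat_cons, cat_cons) [sorted _ (x :: _)]/=.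
by case/andP=> -> _ ->.
Qed.

Lemma push_reduced l w : reduced w -> reduced (push l w).
Proof.
case: w => [//|x w] rw /=; case: eqP => [_|/eqP ne]; first exact: reduced_behead rw.
by rewrite reduced_cons2 ne.
Qed.

Lemma foldr_push_reduced z w : reduced z -> reduced (foldr push z w).
Proof. by move=> rz; elim: w => //= l w; apply: push_reduced. Qed.

Lemma reduce_reduced w : reduced (reduce w).
Proof. exact: foldr_push_reduced. Qed.

Lemma reduce_id w : reduced w -> reduce w = w.
Proof.
elim: w => //= l w IH rlw; rewrite IH ?(reduced_behead rlw) //.
by case: w rlw {IH} => //= d w; rewrite reduced_cons2 => /andP[/negbTE ->].
Qed.

(** Pushing is thus an action of the free group on reduced words; reducedness of [w] forbids a
    second cancellation after the first. *)
Lemma pushK l w : reduced w -> push (linv l) (push l w) = w.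
Proof.
case: w => [|x w] rw /=; rewrite ?linvK ?eqxx //.
case: (x =P linv l) => [def_x | _] /=; last by rewrite linvK eqxx.
case: w rw => [|y w] /=; first by rewrite def_x.
by rewrite reduced_cons2 def_x => /andP[/negbTE -> _].
Qed.

Lemma pushKV l w : reduced w -> push l (push (linv l) w) = w.
Proof. by move=> rw; rewrite -{1}(linvK l) pushK. Qed.

(** A cancelling pair in [u] acts trivially by [pushKV]. This is what makes [=F] a congruence for
    concatenation. *)
Lemma foldr_push_reduce z u :
  reduced z -> foldr push z (reduce u) = foldr push z u.
Proof.
move=> rz; elim: u => //= l u IH; rewrite -IH.
case: (reduce u) => //= x w; case: eqP => // ->.
by rewrite pushKV ?foldr_push_reduced.
Qed.

Lemma reduce_cat u v : reduce (u ++ v) = foldr push (reduce v) u.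
Proof. by rewrite /reduce foldr_cat. Qed.

Lemma weq_reduce u : reduce u =F u.
Proof. exact/reduce_id/reduce_reduced. Qed.

#[global] Instance reduce_weq : Proper (weq ==> eq) reduce.
Proof. by []. Qed.

#[global] Instance cat_weq : Proper (weq ==> weq ==> weq) (@cat letter).
Proof.
move=> u u' eu v v' ev; rewrite /weq !reduce_cat -[RHS]foldr_push_reduce ?reduce_reduced //.
by rewrite -eu -ev foldr_push_reduce ?reduce_reduced.
Qed.

Lemma weq_reduced u v : reduced u -> reduced v -> u =F v -> u = v.
Proof. by rewrite /weq => /reduce_id {2}<- /reduce_id {2}<-. Qed.

Lemma size_push l w : size (push l w) <= (size w).+1.
Proof. by case: w => //= x w; case: eqP => //= _; lia. Qed.

Lemma size_reduce w : size (reduce w) <= size w.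
Proof. by elim: w => //= l w IH; apply: leq_trans (size_push _ _) _. Qed.

Lemma winv_cat u v : winv (u ++ v) = winv v ++ winv u.
Proof. by rewrite /winv map_cat rev_cat. Qed.

Lemma winv_cons l u : winv (l :: u) = winv u ++ [:: linv l].
Proof. by rewrite -cat1s winv_cat. Qed.

Lemma winvK : involutive winv.
Proof. by move=> u; rewrite /winv map_rev revK mapK //; apply: linvK. Qed.

Lemma size_winv u : size (winv u) = size u.
Proof. by rewrite size_rev size_map. Qed.

Lemma reduced_winv u : reduced (winv u) = reduced u.
Proof.
rewrite /reduced /winv rev_sorted sorted_map; apply: eq_sorted => x y /=.
by rewrite (inj_eq linv_inj) eq_sym -(inj_eq linv_inj) linvK.
Qed.

Lemma weq_catV u : u ++ winv u =F [::].
Proof.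
elim: u => //= l u IH.
rewrite winv_cons -(cat1s l) (catA u) IH.
by rewrite /weq /= eqxx.
Qed.

Lemma weq_Vcat u : winv u ++ u =F [::].
Proof. by rewrite -{2}(winvK u) weq_catV. Qed.

Lemma weq_catKV u v : winv u ++ (u ++ v) =F v.
Proof. by rewrite catA weq_Vcat. Qed.

Lemma weq_catVK u v : u ++ (winv u ++ v) =F v.
Proof. by rewrite catA weq_catV. Qed.

Lemma weq_catI u v w : u ++ v =F u ++ w -> v =F w.
Proof. by move=> e; rewrite -(weq_catKV u v) e weq_catKV. Qed.

#[global] Instance winv_weq : Proper (weq ==> weq) winv.
Proof.
move=> u v e; apply: (@weq_catI u); rewrite weq_catV {1}e weq_catV; reflexivity.
Qed.

(** * Substitution of words for letters *)

Definition sub (f : letter -> word) (w : word) : word := flatten (map f w).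

Definition hom (f : letter -> word) : Prop :=
  forall l, f (linv l) =F winv (f l).

Lemma sub_cons f l w : sub f (l :: w) = f l ++ sub f w.
Proof. by []. Qed.

Lemma sub_cat f u v : sub f (u ++ v) = sub f u ++ sub f v.
Proof. by rewrite /sub map_cat flatten_cat. Qed.

Lemma sub1 f l : sub f [:: l] = f l.
Proof. exact: cats0. Qed.

Lemma sub_sub f g w : sub f (sub g w) = sub (sub f \o g) w.
Proof. by elim: w => //= l w IH; rewrite !sub_cons sub_cat IH. Qed.

Lemma sub_letters f (p : letter -> letter) w : sub f (map p w) = sub (f \o p) w.
Proof. by rewrite /sub -map_comp. Qed.

Lemma sub_ext f g w : (forall l, f l =F g l) -> sub f w =F sub g w.
Proof.
move=> e; elim: w => [|l w IH]; first reflexivity.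
by rewrite !sub_cons e IH.
Qed.

Lemma sub_id w : sub (fun l => [:: l]) w = w.
Proof. by elim: w => //= l w IH; rewrite sub_cons IH. Qed.

Lemma weq_sub f u v : hom f -> u =F v -> sub f u =F sub f v.
Proof.
move=> hf e; suffices red w : sub f (reduce w) =F sub f w by rewrite -red e red.
elim: w => [|l w IH /=]; first reflexivity.
rewrite sub_cons -IH; case: (reduce w) => [|x r] /=; first reflexivity.
case: eqP => [->|_]; last reflexivity.
by rewrite sub_cons hf weq_catVK; reflexivity.
Qed.

Lemma sub_winv f w : hom f -> sub f (winv w) =F winv (sub f w).
Proof.
move=> hf; elim: w => [|l w IH]; first reflexivity.
by rewrite winv_cons sub_cat sub1 sub_cons winv_cat IH hf; reflexivity.
Qed.

Lemma hom_img x y : hom (img x y).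
Proof. by case=> g [] /=; rewrite /img /linv /= ?winvK; reflexivity. Qed.

Lemma hom_imgE f l : hom f -> img (f (false, false)) (f (true, false)) l =F f l.
Proof. by move=> hf; case: l => [[] []]; rewrite /img /= -?hf; reflexivity. Qed.

Lemma hom_comp f g : hom f -> hom g -> hom (sub f \o g).
Proof. by move=> hf hg l /=; rewrite -sub_winv //; apply: weq_sub. Qed.

Lemma endoE x y w : endo x y w = reduce (sub (img x y) w).
Proof. by []. Qed.

(** * Cyclic length *)

(** The square is reduced exactly when [c] is reduced and its ends do not cancel, that is, when [c]
    is cyclically reduced. *)
Definition cyc (c : word) : bool := reduced (c ++ c).

Lemma cyc_reduced c : cyc c -> reduced c.
Proof. exact: reduced_catl. Qed.

Lemma cred_aux_spec n w : size w <= n -> reduced w ->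
  exists g, w = g ++ cred_aux n w ++ winv g /\ cyc (cred_aux n w).
Proof.
elim: n w => [|n IH] [|x w'] //= sz rw; try by exists [::].
case: ifPn => [/andP[]|].
  case/lastP: w' sz rw => // m y sz rw _.
  rewrite last_rcons belast_rcons => /eqP def_y /=.
  have rm : reduced m.
    by move: rw; rewrite -cats1 => /reduced_behead; apply: reduced_catl.
  case: (IH m _ rm) => [|g [def_m cc]].
    by move: sz; rewrite size_rcons; lia.
  exists (x :: g); split=> //.
  by rewrite def_y -cats1 winv_cons cat_cons {1}def_m -!catA.
move=> nc; exists [::]; split; first by rewrite cats0.
rewrite /cyc /reduced sorted_cat_cons /= rcons_path.
have rw' : path (fun x y => y != linv x) x w' by [].
rewrite rw' andbT /=; case: w' nc {sz rw rw'} => [|y w'] /=.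
  by rewrite eq_sym linv_neq.
by rewrite -(inj_eq linv_inj) linvK eq_sym.
Qed.

Lemma cyc_reduce_spec w : reduced w ->
  exists g, w = g ++ cyc_reduce w ++ winv g /\ cyc (cyc_reduce w).
Proof. exact: cred_aux_spec. Qed.

Definition pow (c : word) n : word := flatten (nseq n c).

Lemma powS c n : pow c n.+1 = c ++ pow c n.
Proof. by []. Qed.

Lemma size_pow c n : size (pow c n) = n * size c.
Proof. by elim: n => //= n IH; rewrite size_cat IH mulSn. Qed.

Lemma reduced_pow c n : cyc c -> reduced (pow c n).
Proof.
move=> cc; case: (altP (c =P [::])) => [->|c_n0]; first by elim: n.
suffices: reduced (c ++ pow c n) by apply: reduced_catr.
elim: n => [|n IH]; first by rewrite cats0 cyc_reduced.
exact: reduced_glue.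
Qed.

Lemma pow_conj c h n : pow (h ++ c ++ winv h) n =F h ++ pow c n ++ winv h.
Proof.
elim: n => [|n IH]; first by rewrite /= weq_catV; reflexivity.
by rewrite !powS IH -!catA weq_catKV; reflexivity.
Qed.

#[global] Instance pow_weq : Proper (weq ==> eq ==> weq) pow.
Proof. by move=> u v e n _ <-; elim: n => [|n IH]; rewrite ?powS; [reflexivity | exact: cat_weq]. Qed.

(* Powers grow with slope the cyclic length, up to the bounded cost of conjugation. *)
Lemma cyc_conj_size_le c d h : cyc c -> c =F h ++ d ++ winv h -> size c <= size d.
Proof.
move=> cc e; rewrite leqNgt; apply/negP => lt.
(* With this exponent the power of [c] would outgrow that of [d] by at least [n] letters, more than
   the [2 * size h] spent on conjugation. *)
have [n def_n] : exists n, n = (2 * size h).+1 by eexists.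
have := size_reduce (h ++ pow d n ++ winv h).
have -> : reduce (h ++ pow d n ++ winv h) = pow c n.
  rewrite -[RHS](reduce_id (reduced_pow n cc)).
  by apply/esym; change (pow c n =F h ++ pow d n ++ winv h); rewrite -pow_conj -e; reflexivity.
have : n * (size d).+1 <= n * size c by rewrite leq_mul2l lt orbT.
by rewrite !size_cat !size_pow size_winv mulnS; lia.
Qed.

Definition conjw (u v : word) : Prop := exists h, u =F h ++ v ++ winv h.

Lemma conjw_refl u v : u =F v -> conjw u v.
Proof. by move=> e; exists [::]; rewrite cats0. Qed.

Lemma conjw_sym u v : conjw u v -> conjw v u.
Proof.
case=> h e; exists (winv h); rewrite e winvK -!catA weq_Vcat cats0 weq_catKV; reflexivity.
Qed.

Lemma conjw_trans u v w : conjw u v -> conjw v w -> conjw u w.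
Proof.
case=> h e [k e']; exists (h ++ k).
by rewrite e e' winv_cat -!catA; reflexivity.
Qed.

Lemma conjw_sub f u v : hom f -> conjw u v -> conjw (sub f u) (sub f v).
Proof.
move=> hf [h e]; exists (sub f h).
by rewrite (weq_sub hf e) !sub_cat sub_winv //; reflexivity.
Qed.

Lemma conjw_cyclen u c : conjw u c -> cyc c -> cyclen (reduce u) = size c.
Proof.
move=> uc cc; have [g [def_u cu]] := cyc_reduce_spec (reduce_reduced u).
have cu' : conjw (cyc_reduce (reduce u)) c.
  apply: conjw_trans uc; apply: conjw_sym; exists g.
  by rewrite -def_u weq_reduce; reflexivity.
have [h e] := cu'; have [k e'] := conjw_sym cu'.
by apply/eqP; rewrite eqn_leq (cyc_conj_size_le cu e) (cyc_conj_size_le cc e').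
Qed.

Lemma conjw_cyclen_eq u v : conjw u v -> cyclen (reduce u) = cyclen (reduce v).
Proof.
move=> uv; have [g [def_v cv]] := cyc_reduce_spec (reduce_reduced v).
rewrite (conjw_cyclen (conjw_trans uv _) cv) //.
by exists g; rewrite -def_v weq_reduce; reflexivity.
Qed.

Lemma conjw_cyc_reduce w : reduced w -> conjw w (cyc_reduce w) /\ cyc (cyc_reduce w).
Proof. by case/cyc_reduce_spec=> g [def_w cw]; split=> //; exists g; rewrite -def_w; reflexivity. Qed.

Lemma conj_square_reduced g c : c != [::] -> cyc c ->
  reduced (g ++ c ++ winv g) -> reduced (g ++ (c ++ c) ++ winv g).
Proof.
move=> c0 cc r; rewrite -catA; apply: reduced_glue => //.
  by apply: (@reduced_catl _ (winv g)); rewrite -catA.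
exact/reduced_glue/(reduced_catr r).
Qed.

(** Squaring [g c g^-1] inserts exactly one more copy of the cyclic core [c]. The algorithm computes
    cyclic lengths by this formula. *)
Lemma cyclen_square w : reduced w -> cyclen w = size (reduce (w ++ w)) - size w.
Proof.
move=> rw; have [g [def_w cw]] := cyc_reduce_spec rw; rewrite /cyclen.
set c := cyc_reduce w in def_w cw *; case: (altP (c =P [::])) => [c0|c_n0].
  have -> : w = [::] by apply: weq_reduced => //; rewrite def_w c0 weq_catV; reflexivity.
  by rewrite c0.
have -> : reduce (w ++ w) = g ++ (c ++ c) ++ winv g.
  rewrite -[RHS]reduce_id; last by apply: conj_square_reduced => //; rewrite -def_w.
  change (w ++ w =F g ++ (c ++ c) ++ winv g).
  have e : w =F g ++ c ++ winv g by rewrite -def_w; reflexivity.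
  by rewrite e -!catA weq_catKV; reflexivity.
by rewrite {1}def_w !size_cat; lia.
Qed.

Lemma size_square w : reduced w -> w != [::] -> size w < size (reduce (w ++ w)).
Proof.
move=> rw w0; have [g [def_w cw]] := cyc_reduce_spec rw.
have := cyclen_square rw; rewrite /cyclen.
case: (altP (cyc_reduce w =P [::])) => [c0|]; last by case: (cyc_reduce w) => //= *; lia.
by case/eqP: w0; apply: weq_reduced => //; rewrite def_w c0 weq_catV; reflexivity.
Qed.

(** * Stretching a cyclic word *)

Definition kept (g : bool) (c : letter) : word := if c.1 == g then [:: c] else [::].

(** Whatever the generator, the image of a positive letter ends with the added letter and that of a
    negative one begins with its inverse; a letter on [~~ g] is its own added letter. So what is
    added between two letters depends on their signs only. *)
Definition stretch (g : bool) (c : letter) : word :=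
  if c.2 then (~~ g, true) :: kept g c else rcons (kept g c) (~~ g, false).

Definition hsign (d : bool) (w : word) : bool := if w is c :: _ then c.2 else d.

(** Two positive letters leave the letter added by the first, two negative ones that added by the
    second; from positive to negative the two cancel, from negative to positive there is none. *)
Definition junction (g e e' : bool) : word := if e == e' then [:: (~~ g, e)] else [::].

Fixpoint emit (g : bool) (w : word) (d : bool) : word :=
  if w is c :: w' then kept g c ++ junction g c.2 (hsign d w') ++ emit g w' d else [::].

(* [stretch g] on a cyclic word, without cancellation: keep the letters on the
   generator [g], drop the others, and insert a letter on the other generator
   between any two cyclically consecutive letters of equal sign. *)
Definition sigma (g : bool) (w : word) : word := emit g w (hsign false w).

Fixpoint sign_changes (w : word) (d : bool) : nat :=
  if w is c :: w' then (c.2 != hsign d w') + sign_changes w' d else 0.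

Definition cyc_sign_changes (w : word) : nat := sign_changes w (hsign false w).

Lemma hsign_cat d u v : hsign d (u ++ v) = hsign (hsign d v) u.
Proof. by case: u. Qed.

Lemma hsign_nonempty d d' w : w != [::] -> hsign d w = hsign d' w.
Proof. by case: w. Qed.

Lemma emit_cat g u v d : emit g (u ++ v) d = emit g u (hsign d v) ++ emit g v d.
Proof. by elim: u => //= c u IH; rewrite IH hsign_cat !catA. Qed.

Lemma sign_changes_cat u v d :
  sign_changes (u ++ v) d = sign_changes u (hsign d v) + sign_changes v d.
Proof. by elim: u => //= c u ->; rewrite hsign_cat addnA. Qed.

Lemma hom_stretch g : hom (stretch g).
Proof. by case=> [h []]; rewrite /stretch /kept /=; case: (h == g); reflexivity. Qed.

(** [left] is what a negative letter puts in front of itself. Regrouping by junctions strips it from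
    the head of the word and borrows that of the following letter; on a cyclic word the two agree,
    so regrouping is a conjugation. *)
Lemma stretch_emit g w d :
  let left b : word := if b then [:: (~~ g, true)] else [::] in
  sub (stretch g) w ++ left d =F left (hsign d w) ++ emit g w d.
Proof.
move=> left; elim: w => [|c w IH] /=; first by rewrite cats0; reflexivity.
rewrite sub_cons -catA IH /stretch /junction !catA.
apply: cat_weq; last reflexivity.
by case: (hsign d w); case: c => [h []] /=; case: g {IH} @left; case: h.
Qed.

Lemma conjw_stretch g w : conjw (sub (stretch g) w) (sigma g w).
Proof.
have /= := stretch_emit g w (hsign false w).
rewrite (_ : hsign (hsign false w) w = hsign false w); last by case: w.
set l := (if _ then _ else _) => e; exists l.
by rewrite catA -e -catA weq_catV cats0; reflexivity.
Qed.

(** Where nothing is inserted the sign changes, and reducedness then forces neighbours onto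
    different generators. The second conjunct lists the possible first letters, which the induction
    needs. *)
Lemma emit_reduced g c w d : reduced (c :: w) ->
  reduced (emit g (c :: w) d) &&
  (if emit g (c :: w) d is h :: _
   then (h == c) || (c.1 != g) && (h == (g, ~~ c.2)) else c.1 != g).
Proof.
elim: w c => [|c' w IH] c.
  by case: c => [[] []]; case: g; case: d.
rewrite reduced_cons2 => /andP[cc' rw].
have := IH c' rw; rewrite [emit g (c :: c' :: w) d]/=.
rewrite -[kept g c' ++ _]/(emit g (c' :: w) d).
case: (emit g (c' :: w) d) => [|h E];
  case: c cc' => [[] []]; case: c' {IH rw} => [[] []] //; case: g => //=;
  rewrite /junction //=; case: h => [[] []] //=; rewrite ?reduced_cons2 //=;
  by rewrite ?andbF ?andbT.
Qed.

Lemma sigma_cyc g w : cyc w -> cyc (sigma g w).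
Proof.
case: w => [//|c w]; rewrite /cyc /sigma => cw.
(* Two copies of the emission of a word are the emission of its square. *)
rewrite -{1}[hsign false (c :: w)]/(hsign (hsign false (c :: w)) (c :: w)) -emit_cat.
by have /andP[] := @emit_reduced g c (w ++ c :: w) (hsign false (c :: w)) cw.
Qed.

Definition ngen (g : bool) (w : word) : nat := count (fun c => c.1 == g) w.

Lemma ngen_size g w : ngen g w + ngen (~~ g) w = size w.
Proof. by rewrite /ngen; elim: w => //= [[[] e]] w; case: g => /=; lia. Qed.

Lemma ngen_emit g w d : ngen g (emit g w d) = ngen g w.
Proof.
rewrite /ngen; elim: w => //= c w IH; rewrite !count_cat IH /junction /kept.
by case: eqP => /= [->|_]; case: ifP => _ /=; rewrite ?eqxx; case: g {IH}.
Qed.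

(** One letter is inserted per consecutive pair without sign change. *)
Lemma size_emit g w d :
  size (emit g w d) + sign_changes w d = ngen g w + size w.
Proof.
rewrite /ngen; elim: w => //= c w IH; rewrite !size_cat /junction /kept.
by do 2!case: eqP => _ /=; lia.
Qed.

Lemma ngen_sigma g w : ngen g (sigma g w) = ngen g w.
Proof. exact: ngen_emit. Qed.

Lemma size_sigma g w : size (sigma g w) + cyc_sign_changes w = ngen g w + size w.
Proof. exact: size_emit. Qed.

(** * Sign changes along a path of stretchings *)

Definition walk (p : seq bool) (w : word) : word := foldl (fun w g => sigma g w) w p.

Definition one_sign (e : bool) (r : word) : bool := all (fun c => c.2 == e) r.

Definition mixed (e : bool) (r : word) : bool :=
  [&& one_sign e r, has (fun c => c.1) r & has (fun c => ~~ c.1) r].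

(* The lengths of mixed one-sign blocks are forgotten. *)
Inductive similar : word -> word -> Prop :=
| similar_nil : similar [::] [::]
| similar_cons c w w' : similar w w' -> similar (c :: w) (c :: w')
| similar_mixed e r r' w w' : mixed e r -> mixed e r' -> similar w w' ->
    similar (r ++ w) (r' ++ w').

Definition same_signs (w w' : word) : Prop :=
  forall p, cyc_sign_changes (walk p w) = cyc_sign_changes (walk p w').

Lemma similar_cat2l a w w' : similar w w' -> similar (a ++ w) (a ++ w').
Proof. by move=> s; elim: a => //= c a; apply: similar_cons. Qed.

Lemma hsign_one_sign e r d : one_sign e r -> r != [::] -> hsign d r = e.
Proof. by case: r => //= c r /andP[/eqP]. Qed.

Lemma mixed_nonempty e r : mixed e r -> r != [::].
Proof. by case: r => //; rewrite /mixed andbF. Qed.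

Lemma sign_changes_one_sign e r d : one_sign e r -> r != [::] ->
  sign_changes r d = (e != d).
Proof.
elim: r => // c [|c' r] IH /andP[/eqP ce sr] _; first by rewrite /= ce addn0.
rewrite -[LHS]/((c.2 != c'.2) + sign_changes (c' :: r) d) IH // ce.
by case/andP: sr => /eqP -> _; rewrite eqxx.
Qed.

Lemma hsign_similar d w w' : similar w w' -> hsign d w = hsign d w'.
Proof.
case=> // e r r' v v' mr mr' _; have [/and3P[sr _ _] /and3P[sr' _ _]] := (mr, mr').
by rewrite !hsign_cat (hsign_one_sign _ sr (mixed_nonempty mr)) (hsign_one_sign _ sr' (mixed_nonempty mr')).
Qed.

Lemma sign_changes_similar d w w' : similar w w' ->
  sign_changes w d = sign_changes w' d.
Proof.
elim=> //= [c v v' s -> | e r r' v v' mr mr' s IH]; first by rewrite (hsign_similar _ s).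
have [/and3P[sr _ _] /and3P[sr' _ _]] := (mr, mr').
rewrite !sign_changes_cat IH (hsign_similar d s).
by rewrite (sign_changes_one_sign _ sr (mixed_nonempty mr)) (sign_changes_one_sign _ sr' (mixed_nonempty mr')).
Qed.

Lemma one_sign_emit g e r d : one_sign e r -> one_sign e (emit g r d).
Proof.
elim: r => //= c r IH /andP[/eqP ce /IH sr].
rewrite /one_sign !all_cat -!/(one_sign e _) sr andbT /kept /junction.
by rewrite ce; do 2!case: ifP => _; rewrite /= ?ce ?eqxx.
Qed.

Lemma emit_inserts g e c c' r d : one_sign e [:: c, c' & r] ->
  has (fun c => c.1 == ~~ g) (emit g [:: c, c' & r] d).
Proof.
case/and3P=> /eqP ce /eqP c'e _.
by rewrite /= ce c'e !has_cat /junction eqxx /= eqxx orbT.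
Qed.

Lemma emit_keeps g w d :
  has (fun c => c.1 == g) w -> has (fun c => c.1 == g) (emit g w d).
Proof. by rewrite !has_count -/(ngen g w) -/(ngen g _) ngen_emit. Qed.

Lemma mixedE e g r : mixed e r =
  [&& one_sign e r, has (fun c => c.1 == g) r & has (fun c => c.1 == ~~ g) r].
Proof.
rewrite /mixed; congr (_ && _).
have [ht hf] : has (fun c : letter => c.1) r = has (fun c => c.1 == true) r /\
               has (fun c : letter => ~~ c.1) r = has (fun c => c.1 == false) r.
  by split; apply: eq_has => [[[] ?]].
by rewrite ht hf; case: g => //; rewrite andbC.
Qed.

(** A letter on [g] is kept, and two neighbours of equal sign get a letter on [~~ g] between them.
    In particular mixed blocks stay mixed. *)
Lemma mixed_emit g e r d : one_sign e r -> 1 < size r ->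
  has (fun c => c.1 == g) r -> mixed e (emit g r d).
Proof.
move=> sr r2 hr; rewrite (mixedE _ g) one_sign_emit //= emit_keeps //=.
by case: r sr r2 {hr} => [|c [|c' r]] // sr _; apply: emit_inserts sr.
Qed.

Lemma mixed_size e r : mixed e r -> 1 < size r.
Proof. by rewrite /mixed; case: r => [|c [|c' r]] //=; case: c.1; rewrite ?andbF. Qed.

Lemma emit_similar g d w w' : similar w w' -> similar (emit g w d) (emit g w' d).
Proof.
elim=> [|c v v' s IH|e r r' v v' mr mr' s IH]; first exact: similar_nil.
  by rewrite /= (hsign_similar d s); do 2!apply: similar_cat2l.
rewrite !emit_cat; apply: (@similar_mixed e) => //.
  by apply: mixed_emit (mixed_size mr) _; move: mr; rewrite (mixedE _ g) => /and3P[].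
by apply: mixed_emit (mixed_size mr') _; move: mr'; rewrite (mixedE _ g) => /and3P[].
Qed.

Lemma similar_same_signs w w' : similar w w' -> same_signs w w'.
Proof.
move=> s p; elim: p w w' s => [|g p IH] w w' s /=.
  by rewrite /cyc_sign_changes (hsign_similar _ s) (sign_changes_similar _ s).
by apply: IH; rewrite /sigma (hsign_similar _ s); apply: emit_similar.
Qed.

Lemma rotation_same_signs u v : same_signs (u ++ v) (v ++ u).
Proof.
move=> p; elim: p u v => [|g p IH] u v.
  rewrite /cyc_sign_changes /= !hsign_cat !sign_changes_cat addnC.
  by case: u => [|c u]; case: v.
rewrite /= /sigma !hsign_cat !emit_cat IH.
by case: u => [|c u]; case: v.
Qed.

(** * The potential and its decrease under stretchings *)

Definition bends (c : letter) (w : word) : bool :=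
  if w is d :: _ then (d.2 == c.2) && (d.1 != c.1) else false.

(** The discount for bends makes a mixed pair weigh 5, less than any run of two or more letters on
    one generator, which weighs at least 6. *)
Fixpoint potential (w : word) : nat :=
  if w is c :: w' then 3 - bends c w' + potential w' else 0.

Lemma potential_cat_le u v : potential (u ++ v) <= potential u + potential v.
Proof. by elim: u => //= c [|c' u] /=; lia. Qed.

Lemma potential_cat x u v :
  (last x u).2 != hsign (~~ (last x u).2) v -> potential (u ++ v) = potential u + potential v.
Proof.
elim: u x => //= c [|c' u] IH x /=; last by move/(IH c) => /=; lia.
by case: v {IH} => [|d v] //=; rewrite eq_sym => /negbTE ->.
Qed.

Lemma potential_nseq k c : potential (nseq k c) = 3 * k.
Proof. by elim: k => //= [[|k]] IH; rewrite /= ?eqxx ?andbF in IH *; lia. Qed.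

Lemma potential_le w : potential w <= 3 * size w.
Proof. by elim: w => //= c w; lia. Qed.

(** All letters are dropped, each of the [k] inner junctions puts one back, and the sign change at
    the end puts none. *)
Lemma emit_dropped g e k : emit g (nseq k.+1 (~~ g, e)) (~~ e) = nseq k (~~ g, e).
Proof.
elim: k => [|k IH]; first by case: g; case: e.
rewrite -[LHS]/(kept g (~~ g, e) ++ junction g e e ++ emit g (nseq k.+1 (~~ g, e)) (~~ e)).
by rewrite IH /kept /junction eqxx; case: g {IH}.
Qed.

Lemma pure_nseq (g : bool) e r : one_sign e r -> ~~ has (fun c => c.1 == ~~ g) r ->
  r = nseq (size r) (g, e).
Proof.
elim: r => //= [[h f]] r IH /andP[/= /eqP -> /IH sr].
by rewrite negb_or => /andP[hg /sr {1}->]; congr ((_, _) :: _); case: (h) (g) hg => [] [].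
Qed.

(** A mixed run stays mixed, so it may represent itself; a run on [~~ g] loses a letter; a single
    letter on [g] is unchanged; a longer run on [g] becomes mixed and is represented by a shortest
    mixed block. *)
Lemma run_step g e r : one_sign e r -> r != [::] ->
  exists r', (forall w w', similar w w' -> similar (emit g r (~~ e) ++ w) (r' ++ w'))
    /\ (r' = r \/ potential r' < potential r).
Proof.
move=> sr r0; case mr: (mixed e r).
  exists r; split; last by left.
  move=> w w' s; apply: (@similar_mixed e) => //.
  apply: mixed_emit (mixed_size mr) _ => //.
  by move: mr; rewrite (mixedE _ g) => /and3P[].
case hg: (has (fun c => c.1 == g) r); last first.
  have := @pure_nseq (~~ g) e r sr; rewrite negbK hg => /(_ isT) def_r.
  case: (size r) def_r (size_eq0 r) r0 => [|k] def_r; first by rewrite eqxx => <-.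
  move=> _ _; exists (nseq k (~~ g, e)); rewrite def_r emit_dropped !potential_nseq.
  by split; [move=> w w'; apply: similar_cat2l | right; lia].
have def_r : r = nseq (size r) (g, e).
  by apply: pure_nseq => //; move: mr; rewrite (mixedE _ g) sr hg /= => ->.
case sz: (size r) def_r => [|[|k]] def_r; first by rewrite def_r eqxx in r0.
  exists r; split; last by left.
  move=> w w'; rewrite def_r /= /kept /junction /= eqxx.
  by case: (e) => s; apply: similar_cons.
exists [:: (g, e); (~~ g, e)]; split; last first.
  by right; rewrite def_r potential_nseq /= eqxx; case: (g) => /=; lia.
move=> w w'; apply: (@similar_mixed e); first by apply: mixed_emit; rewrite ?sz.
by rewrite /mixed /= eqxx; case: (g).
Qed.

Lemma first_run c w : exists r v, [/\ c :: w = r ++ v, r != [::], one_sign c.2 r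
  & hsign (~~ c.2) v != c.2].
Proof.
elim: w c => [|c' w IH] c.
  by exists [:: c], [::]; rewrite /= eqxx; split=> //; case: c.2.
have [r [v [def_w r0 sr hv]]] := IH c'; case: (altP (c'.2 =P c.2)) => [e | ne].
  by exists (c :: r), v; split=> //=; rewrite -?e ?eqxx // def_w.
by exists [:: c], (c' :: w); rewrite /= eqxx.
Qed.

Lemma one_sign_last e r x : one_sign e r -> r != [::] -> (last x r).2 = e.
Proof.
elim: r x => //= c [|c' r] IH x /andP[/eqP ce sr] _ //=.
by rewrite -/(last c (c' :: r)) IH.
Qed.

(** Nothing is inserted at a sign change, so maximal runs evolve independently, and the potential of
    [w] is the sum over its runs. The default letter makes the hypothesis hold for the empty
    word. *)
Lemma linear_step g w d : (last (false, ~~ d) w).2 != d ->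
  exists w', similar (emit g w d) w' /\ (w' = w \/ potential w' < potential w).
Proof.
have [n] := ubnP (size w); elim: n w => // n IH [|c w] sz lw.
  by exists [::]; split; [apply: similar_nil | left].
have [r [v [def_w r0 sr hv]]] := first_run c w.
rewrite def_w in sz lw *.
have hv' : hsign d v = ~~ c.2.
  case: v lw {sz def_w} hv => [|c' v] /=; last by case: c'.2; case: c.2.
  by rewrite cats0 (one_sign_last _ sr) //; case: c.2; case: (d).
have [||w' [s' p']] := IH v.
- by move: sz; rewrite size_cat; case: (r) r0 => //= *; lia.
- by case: v lw {sz hv hv' def_w} => [|c' v] /=; rewrite ?last_cat //; case: (d).
have [r' [s p]] := run_step g sr r0.
exists (r' ++ w'); split; first by rewrite emit_cat hv'; apply: s.
have -> : potential (r ++ v) = potential r + potential v.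
  apply: (@potential_cat (false, false)); rewrite (one_sign_last _ sr) //.
  by rewrite eq_sym.
have := potential_cat_le r' w'.
by case: p p' => [-> | ?] [-> | ?] le; [left | right; lia ..].
Qed.

Lemma constant_sign w d : sign_changes w d = 0 -> one_sign d w.
Proof.
elim: w => //= c w IH /eqP; rewrite addn_eq0 => /andP[c0 /eqP/IH sw].
have -> : c.2 = hsign d w by apply/eqP; move: c0; rewrite eqb0 negbK.
by rewrite sw andbT; case: w sw {IH c0} => //= c' w /andP[].
Qed.

Lemma one_sign_no_changes w d : one_sign d w -> sign_changes w d = 0.
Proof. by elim: w => //= c w IH /andP[/eqP -> sw]; rewrite IH //; case: w sw {IH} => //= [|c' w /andP[/eqP ->]]; rewrite eqxx. Qed.

Lemma no_changes_walk p w : cyc_sign_changes w = 0 -> cyc_sign_changes (walk p w) = 0.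
Proof.
elim: p w => //= g p IH w /constant_sign sw; apply: IH.
have := one_sign_emit g (hsign false w) sw; rewrite -/(sigma g w) => se.
apply: one_sign_no_changes; case: (sigma g w) se => //= c v /andP[/eqP -> ->].
by rewrite eqxx.
Qed.

Lemma sign_change_split w d : 0 < sign_changes w d ->
  exists u v, [/\ w = u ++ v, u != [::] & forall x, (last x u).2 != hsign d v].
Proof.
elim: w => //= c w IH; case: (altP (c.2 =P hsign d w)) => [e /IH|ne _].
  by case=> u [v [-> u0 lu]]; exists (c :: u), v; split=> // x; apply: lu.
by exists [:: c], w.
Qed.

(** Cutting at a sign change destroys no bend, and joining the old ends can only create one, so the
    potential does not grow. *)
Lemma rotate_to_sign_change w : 0 < cyc_sign_changes w ->
  exists w1, [/\ same_signs w w1, potential w1 <= potential w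
    & forall x, (last x w1).2 != hsign false w1].
Proof.
case/sign_change_split=> u [v [-> u0 lu]]; exists (v ++ u).
have lu' x : (last x u).2 != hsign (hsign false u) v by have := lu x; rewrite hsign_cat (@hsign_nonempty _ false u).
split=> [||x]; first exact: rotation_same_signs.
  rewrite (@potential_cat (false, false) u v); first by rewrite addnC potential_cat_le.
  by case: v lu {lu'} => [|c v] lu //=; case: (last _ _).2.
by rewrite last_cat hsign_cat.
Qed.

Lemma sigma_step g w : (forall x, (last x w).2 != hsign false w) ->
  exists w', same_signs (sigma g w) w' /\ (w' = w \/ potential w' < potential w).
Proof.
move=> lw; have [w' [s p]] := linear_step g (lw (false, ~~ hsign false w)).
by exists w'; split=> //; apply: similar_same_signs.
Qed.

(** If the first stretching changes neither representative, the inner induction on the path applies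
    to the same pair. Otherwise the total potential drops, which pays for the step used, and the
    outer induction applies with [n.-1]. *)
Lemma short_walks_determine_sign_changes n w v : potential w + potential v <= n ->
  (forall p, size p <= n -> cyc_sign_changes (walk p w) = cyc_sign_changes (walk p v)) ->
  same_signs w v.
Proof.
elim/ltn_ind: n w v => n IH w v le_n e.
have e0 := e [::] isT; rewrite /= in e0.
case: (posnP (cyc_sign_changes w)) => [w0 p | w_gt0].
  by rewrite !no_changes_walk -?e0.
have v_gt0 : 0 < cyc_sign_changes v by rewrite -e0.
have [w1 [sw pw lw]] := rotate_to_sign_change w_gt0.
have [v1 [sv pv lv]] := rotate_to_sign_change v_gt0.
suffices s1 : same_signs w1 v1 by move=> p; rewrite sw s1 -sv.
have {le_n} le_n : potential w1 + potential v1 <= n by lia.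
have {sw sv pw pv w_gt0 v_gt0 e0} e p : size p <= n ->
    cyc_sign_changes (walk p w1) = cyc_sign_changes (walk p v1).
  by move=> le_p; rewrite -sw -sv e.
move=> p; elim: p => [|g p IHp]; first exact: e.
have [w' [sw pw]] := sigma_step g lw; have [v' [sv pv]] := sigma_step g lv.
rewrite /= sw sv.
have drop : potential w' + potential v' < potential w1 + potential v1 ->
    cyc_sign_changes (walk p w') = cyc_sign_changes (walk p v').
  move=> lt; apply: (IH n.-1); [lia | lia |] => q le_q.
  by rewrite -sw -sv; apply: (e (g :: q)) => /=; lia.
by case: pw drop => [->|ltw]; case: pv => [->|ltv] drop //; apply: drop; lia.
Qed.

Lemma walk_rcons p g w : walk (rcons p g) w = sigma g (walk p w).
Proof. by rewrite /walk foldl_rcons. Qed.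

(** Adding [size_sigma] for both generators gives [3 * size w] as the two stretched sizes plus twice
    the sign changes; the letter counts follow. *)
Lemma size_sign_ngen w v :
  size w = size v -> (forall g, size (sigma g w) = size (sigma g v)) ->
  cyc_sign_changes w = cyc_sign_changes v /\ forall g, ngen g w = ngen g v.
Proof.
move=> e es; have := (es true, es false).
have := (size_sigma true w, size_sigma false w, size_sigma true v, size_sigma false v).
have /= := (ngen_size true w, ngen_size true v).
case=> n1 n2 [[[s1 s2] s3] s4] [e1 e2].
have et : ngen true w = ngen true v by lia.
by split=> [|[]]; lia.
Qed.

(** The extra step in [n.+1] is there because the letter counts and sign changes of a word are read
    off its two stretchings. Along longer paths equal sign changes propagate equal counts. *)
Lemma short_walks_determine_sizes n w v : potential w + potential v <= n ->
  (forall p, size p <= n.+1 -> size (walk p w) = size (walk p v)) ->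
  forall p, size (walk p w) = size (walk p v).
Proof.
move=> le_n e.
have sc p : size p <= n -> cyc_sign_changes (walk p w) = cyc_sign_changes (walk p v) /\
    forall g, ngen g (walk p w) = ngen g (walk p v).
  move=> le_p; apply: size_sign_ngen; first by apply: e; lia.
  by move=> g; rewrite -!walk_rcons e // size_rcons.
have s : same_signs w v.
  by apply: short_walks_determine_sign_changes le_n _ => p /sc[].
suffices ng p g : ngen g (walk p w) = ngen g (walk p v).
  by move=> p; rewrite -!(ngen_size true) !ng.
elim/last_ind: p g => [|p h IH] g; first exact: (sc [::] isT).2.
have sz u : size u = ngen true u + ngen false u by rewrite -(ngen_size true).
rewrite !walk_rcons; case: (altP (g =P h)) => [->|ne]; first by rewrite !ngen_sigma.
have -> : g = ~~ h by case: g h ne {IH} => [] [].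
have := (size_sigma h (walk p w), size_sigma h (walk p v)).
rewrite !(sz (walk _ _)) !IH s -!(ngen_size h (sigma _ _)) !ngen_sigma !IH => -[]; lia.
Qed.

(** * Automorphisms up to conjugation and signed permutations *)

Definition signed (p : letter -> letter) : Prop :=
  injective p /\ forall l, p (linv l) = linv (p l).

Lemma signed_comp p q : signed p -> signed q -> signed (p \o q).
Proof. by case=> ip sp [iq sq]; split=> [|l /=]; [apply: inj_comp | rewrite sq sp]. Qed.

Lemma signed_id : signed id.
Proof. by split. Qed.

Lemma reduced_map p w : signed p -> reduced (map p w) = reduced w.
Proof.
case=> ip sp; rewrite /reduced sorted_map; apply: eq_sorted => x y /=.
by rewrite -sp (inj_eq ip).
Qed.

Lemma hom_signed p : signed p -> hom (fun l => [:: p l]).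
Proof. by case=> _ sp l; rewrite sp; reflexivity. Qed.

Lemma sub_signed (p : letter -> letter) w : sub (fun l => [:: p l]) w = map p w.
Proof. by elim: w => //= l w IH; rewrite sub_cons IH. Qed.

Lemma map_cyc p c : signed p -> cyc (map p c) = cyc c.
Proof. by move=> sp; rewrite /cyc -map_cat reduced_map. Qed.

Lemma conjw_map p u v : signed p -> conjw u v -> conjw (map p u) (map p v).
Proof. by move=> sp uv; rewrite -!sub_signed; apply: conjw_sub => //; apply: hom_signed. Qed.

Lemma cyclen_map p u : signed p -> cyclen (reduce (map p u)) = cyclen (reduce u).
Proof.
move=> sp; have [uc cc] := conjw_cyc_reduce (reduce_reduced u).
have uc' : conjw u (cyc_reduce (reduce u)).
  by apply: conjw_trans uc; apply/conjw_refl; rewrite weq_reduce; reflexivity.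
by rewrite (conjw_cyclen uc' cc) (conjw_cyclen (conjw_map sp uc')) ?map_cyc ?size_map.
Qed.

Definition stretch_walk (p : seq bool) (w : word) : word :=
  foldl (fun w g => sub (stretch g) w) w p.

Lemma conjw_stretch_walk p u v : conjw u v -> conjw (stretch_walk p u) (stretch_walk p v).
Proof.
by elim: p u v => //= g p IH u v uv; apply/IH/conjw_sub => //; apply: hom_stretch.
Qed.

Lemma conjw_walk p u c : conjw u c -> conjw (stretch_walk p u) (walk p c).
Proof.
elim: p u c => //= g p IH u c uc; apply: IH.
exact: conjw_trans (conjw_sub (@hom_stretch g) uc) (conjw_stretch g c).
Qed.

Lemma walk_cyc p c : cyc c -> cyc (walk p c).
Proof. by elim: p c => //= g p IH c cc; apply/IH/sigma_cyc. Qed.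

Lemma cyclen_stretch_walk p u c : conjw u c -> cyc c ->
  cyclen (reduce (stretch_walk p u)) = size (walk p c).
Proof. by move=> uc cc; apply: conjw_cyclen (walk_cyc p cc); apply: conjw_walk. Qed.

Lemma conjw_sub_ext f f' h u : (forall l, f l =F h ++ f' l ++ winv h) ->
  conjw (sub f u) (sub f' u).
Proof.
move=> e; exists h; elim: u => [|l u IH]; first by rewrite weq_catV; reflexivity.
by rewrite !sub_cons e IH -!catA weq_catKV; reflexivity.
Qed.

(** The signed permutation acts first, so a transvection precomposed with [V] can be moved past it
    to meet the first stretching. *)
Definition walkable (V : letter -> word) : Prop :=
  exists p q, signed q /\
    forall u, cyclen (reduce (sub V u)) = cyclen (reduce (stretch_walk p (map q u))).

Lemma walkable_conj V V' : (forall u, conjw (sub V u) (sub V' u)) ->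
  walkable V' -> walkable V.
Proof.
by move=> c [p [q [sq e]]]; exists p, q; split=> // u; rewrite -e; apply: conjw_cyclen_eq.
Qed.

Definition transvection (l m : letter) (x : letter) : word :=
  if x == l then [:: l; m] else if x == linv l then [:: linv m; linv l] else [:: x].

Lemma hom_transvection l m : hom (transvection l m).
Proof.
move=> x; rewrite /transvection (inj_eq linv_inj) -(inj_eq linv_inj (linv x)) linvK.
case: (x =P l) => [->|_]; first by rewrite eq_sym linv_neq; reflexivity.
by case: eqP => _; rewrite /winv /= ?linvK; reflexivity.
Qed.

Lemma transvection_inv l m x : l.1 != m.1 ->
  sub (transvection l m) (transvection l (linv m) x) =F [:: x].
Proof. by case: l => [[] []]; case: m => [[] []] //=; case: x => [[] []]. Qed.

Lemma map_transvection p l m u : signed p ->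
  map p (sub (transvection l m) u) = sub (transvection (p l) (p m)) (map p u).
Proof.
case=> ip sp; elim: u => //= x u IH; rewrite !sub_cons map_cat IH; congr (_ ++ _).
by rewrite /transvection -sp !(inj_eq ip); case: eqP => // _; case: eqP => //=; rewrite !sp.
Qed.

Definition flip (g : bool) (l : letter) : letter := (l.1, l.2 (+) (l.1 == g)).

Lemma signed_flip g : signed (flip g).
Proof. by split=> [[[] []] [[] []]|[[] []]] //; case: g. Qed.

Definition quarter_turn (g : bool) (l : letter) : letter := (~~ l.1, l.2 (+) (l.1 == g)).

Lemma signed_quarter_turn g : signed (quarter_turn g).
Proof. by split=> [[[] []] [[] []]|[[] []]] //; case: g. Qed.

Lemma stretch_transvection g u :
  sub (stretch g) u =F sub (transvection (g, false) (~~ g, false)) u.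
Proof. by apply: sub_ext; case=> [[] []]; case: g. Qed.

(* A leading contraction is absorbed by the walk: it cancels a stretch along the
   same generator, while a stretch along the other generator turns it into a
   stretch preceded by a quarter turn. *)
Lemma contraction_walk g p : exists p' q, signed q /\ forall u,
  cyclen (reduce (stretch_walk p (sub (transvection (g, false) (~~ g, true)) u)))
  = cyclen (reduce (stretch_walk p' (map q u))).
Proof.
case: p => [|h p].
  (* With no stretching to meet, a sign flip of the image, invisible to cyclic length, turns the
     contraction into a stretching. *)
  exists [:: g], (flip (~~ g)); split=> [|u /=]; first exact: signed_flip.
  rewrite -(cyclen_map _ (signed_flip (~~ g))) map_transvection; last exact: signed_flip.
  by rewrite stretch_transvection; case: (g).
case: (altP (h =P g)) => [->|ne].
  exists p, id; split=> [|u /=]; first exact: signed_id.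
  apply/conjw_cyclen_eq/conjw_stretch_walk/conjw_refl.
  rewrite map_id sub_sub -[X in _ =F X]sub_id; apply: sub_ext.
  by case=> [[] []]; case: (g).
have -> : h = ~~ g by case: h g ne => [] [].
(* Writing [a], [b] for the generators [g], [~~ g]: the composite sends [a] to [b^-1] and [b] to
   [b a], which is the pair [b^-1], [a b] conjugated by [b]. *)
exists (g :: p), (quarter_turn g); split=> [|u /=]; first exact: signed_quarter_turn.
apply/conjw_cyclen_eq/conjw_stretch_walk; rewrite sub_sub sub_letters.
apply: (@conjw_sub_ext _ _ [:: (~~ g, false)]).
by case=> [[] []]; case: (g).
Qed.

(** Conjugation turns multiplication on the left into multiplication on the right, so only a
    stretching, prepended to the walk, and a contraction, absorbed by it, remain. *)
Lemma transvection_walk l m p : l.1 != m.1 -> exists p' q, signed q /\ forall u,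
  cyclen (reduce (stretch_walk p (sub (transvection l m) u)))
  = cyclen (reduce (stretch_walk p' (map q u))).
Proof.
case: l m => [g e] [g' e'] /= ne; have {ne} -> : g' = ~~ g by case: g g' ne => [] [].
have st u : conjw (sub (transvection (g, e) (~~ g, e')) u)
                  (sub (transvection (g, false) (~~ g, e (+) e')) u).
  apply: (@conjw_sub_ext _ _ (if e then [:: (~~ g, e (+) e')] else [::])) => x.
  by case: x => [[] []]; case: (g); case: e; case: e'.
case ee: (e (+) e') st => st.
  have [p' [q [sq eq]]] := contraction_walk g p; exists p', q; split=> // u.
  by rewrite -eq; apply/conjw_cyclen_eq/conjw_stretch_walk.
exists (g :: p), id; split=> [|u /=]; [exact: signed_id | rewrite map_id].
apply/conjw_cyclen_eq/conjw_stretch_walk/(conjw_trans (st u))/conjw_refl.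
by rewrite stretch_transvection; reflexivity.
Qed.

Lemma walkable_transvection V l m : l.1 != m.1 -> walkable V ->
  walkable (sub V \o transvection l m).
Proof.
move=> ne [p [q [sq e]]].
have ne' : (q l).1 != (q m).1.
  have [iq sq'] := sq; apply: contra ne => /eqP eq1.
  have : q l = q m \/ q l = q (linv m).
    by rewrite sq'; case: (q l) (q m) eq1 => [g []] [g' []] /= ->; [left|right|right|left].
  by case=> /iq ->.
have [p' [q' [sq' e']]] := transvection_walk p ne'.
exists p', (q' \o q); split=> [|u]; first exact: signed_comp.
by rewrite -sub_sub e map_transvection // e' -map_comp.
Qed.

(** * Nielsen reduction *)

Definition inverse_homs (V W : letter -> word) : Prop :=
  [/\ hom V, hom W, forall l, sub V (W l) =F [:: l] & forall l, sub W (V l) =F [:: l]].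

Definition invertible (V : letter -> word) : Prop := exists W, inverse_homs V W.

Lemma sub_cancel V W u : (forall l, sub V (W l) =F [:: l]) -> sub V (sub W u) =F u.
Proof. by move=> e; rewrite sub_sub -[X in _ =F X]sub_id; apply: sub_ext. Qed.

Lemma invertible_comp V U : invertible V -> invertible U -> invertible (sub V \o U).
Proof.
case=> V' [hV hV' VV' V'V] [U' [hU hU' UU' U'U]]; exists (sub U' \o V').
split=> [||l|l]; [exact: hom_comp | exact: hom_comp | |] => /=.
  by rewrite -sub_sub (weq_sub hV (sub_cancel _ UU')) VV'; reflexivity.
by rewrite -sub_sub (weq_sub hU' (sub_cancel _ V'V)) U'U; reflexivity.
Qed.

Lemma invertible_ext V V' : (forall l, V l =F V' l) -> invertible V -> invertible V'.
Proof.
move=> e [W [hV hW VW WV]]; exists W; split=> // l.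
- by rewrite -!e hV; reflexivity.
- by rewrite -(sub_ext _ e) VW; reflexivity.
- by rewrite -(WV l); apply: weq_sub => //; rewrite e; reflexivity.
Qed.

Lemma invertible_transvection l m : l.1 != m.1 -> invertible (transvection l m).
Proof.
move=> ne; exists (transvection l (linv m)); split=> [||x|x]; try exact: hom_transvection.
  exact: transvection_inv.
by have := @transvection_inv l (linv m) x ne; rewrite linvK.
Qed.

Definition inner (h : word) (l : letter) : word := h ++ [:: l] ++ winv h.

Lemma sub_inner h u : sub (inner h) u =F h ++ u ++ winv h.
Proof.
elim: u => [|l u IH]; first by rewrite weq_catV; reflexivity.
by rewrite sub_cons IH /inner -!catA weq_catKV; reflexivity.
Qed.

Lemma invertible_inner h : invertible (inner h).
Proof.
have hi k : hom (inner k) by move=> l; rewrite /inner !winv_cat winvK -!catA; reflexivity.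
exists (inner (winv h)); split=> // l; rewrite sub_inner /inner winvK -!catA /=.
  by rewrite weq_catVK -cat1s weq_catV; reflexivity.
by rewrite weq_catKV -cat1s weq_Vcat; reflexivity.
Qed.

Fixpoint lcp (u v : word) : nat :=
  match u, v with
  | x :: u', y :: v' => if x == y then (lcp u' v').+1 else 0
  | _, _ => 0
  end.

Definition cancellation (U V : word) : nat := lcp (winv U) V.

Lemma lcpP u v : reduced (winv u) -> reduced v -> exists s u' v',
  [/\ u = s ++ u', v = s ++ v', size s = lcp u v & reduced (winv u' ++ v')].
Proof.
elim: u v => [|x u IH] v ru rv; first by exists [::], [::], v; split=> //; apply: rv.
case: v rv => [|y v] rv; first by exists [::], (x :: u), [::]; split; rewrite ?cats0.
rewrite /=; case: (altP (x =P y)) => [->|ne].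
  have [||s [u' [v' [-> -> <- r]]]] := IH v; last by exists (y :: s), u', v'.
    by apply: (@reduced_catl _ [:: linv x]); rewrite -winv_cons.
  exact: reduced_behead rv.
exists [::], (x :: u), (y :: v); split=> //.
rewrite winv_cons -catA; apply: reduced_glue; rewrite -?winv_cons //=.
by rewrite reduced_cons2 linvK eq_sym ne.
Qed.

Lemma cancellationP U V : reduced U -> reduced V -> exists U1 s V1,
  [/\ U = U1 ++ winv s, V = s ++ V1, size s = cancellation U V,
      reduced (U1 ++ V1) & reduce (U ++ V) = U1 ++ V1].
Proof.
move=> rU rV; have [|s [u [v [eU eV sz r]]]] := @lcpP (winv U) V _ rV.
  by rewrite winvK.
exists (winv u), s, v; split=> //; first by rewrite -(winvK U) eU winv_cat.
rewrite -[RHS]reduce_id //; apply: (_ : _ =F _).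
by rewrite -(winvK U) eU {1}eV winv_cat -catA weq_catKV; reflexivity.
Qed.

Lemma size_reduce_cat U V : reduced U -> reduced V ->
  size (reduce (U ++ V)) + 2 * cancellation U V = size U + size V.
Proof.
move=> rU rV; have [U1 [s [V1 [-> -> <- _ ->]]]] := cancellationP rU rV.
by rewrite !size_cat size_winv; lia.
Qed.

Lemma reduce_winv u : reduce (winv u) = winv (reduce u).
Proof.
rewrite -[RHS]reduce_id ?reduced_winv ?reduce_reduced //; apply: (_ : _ =F _).
by rewrite weq_reduce; reflexivity.
Qed.

(** * Products of words with small cancellation *)

Section SmallCancellation.

Variable V : letter -> word.
Hypothesis V_reduced : forall l, reduced (V l).
Hypothesis V_nonempty : forall l, V l != [::].
Notation canc l m := (cancellation (V l) (V m)).
Hypothesis canc_half : forall l m, m != linv l ->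
  2 * canc l m <= size (V l) /\ 2 * canc l m <= size (V m).
Hypothesis canc_sum : forall l m n, m != linv l -> n != linv m ->
  canc l m + canc m n < size (V m).

Let next (l : letter) (w : word) : nat := if w is m :: _ then canc l m else 0.

(** By [canc_sum] some letter of each factor survives between the cancellations at its two ends, so
    these do not interact. By [canc_half] a further factor on the left never shortens the
    product. *)
Lemma small_cancellation l w : reduced (l :: w) ->
  (exists T, reduce (sub V (l :: w)) = take (size (V l) - next l w) (V l) ++ T)
  /\ (w != [::] -> 1 < size (reduce (sub V (l :: w)))).
Proof.
elim: w l => [|m w IH] l.
  by move=> _; split=> //; exists [::]; rewrite sub1 subn0 take_size cats0 reduce_id.
rewrite reduced_cons2 => /andP[ml rmw].
have [[T eP] sP] := IH m rmw; set P := reduce (sub V (m :: w)) in eP sP.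
have [U1 [s [V1 [eU eV sz rUV _]]]] := cancellationP (V_reduced l) (V_reduced m).
have [h1 h2] := canc_half ml.
have sU : size (V l) = size U1 + size s by rewrite eU size_cat size_winv.
have sV : size (V m) = size s + size V1 by rewrite eV size_cat.
have sl : 0 < size (V l) by rewrite lt0n size_eq0.
have sm : 0 < size (V m) by rewrite lt0n size_eq0.
have lt : size s + next m w < size (V m).
  rewrite sz; case: w rmw {IH sP eP P} => [_|n w] /=; first by rewrite addn0; lia.
  by rewrite reduced_cons2 => /andP[nm _]; apply: canc_sum.
have [q def_q] : exists q, q = next m w by eexists.
have [k def_k] : exists k, k = size V1 - q by eexists.
rewrite -def_q in eP lt.
have eP' : P = s ++ take k V1 ++ T.
  rewrite eP {2}eV take_cat ifF; last by lia.
  by rewrite -catA; congr (_ ++ (take _ _ ++ _)); lia.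
have sV1 : 0 < size V1 by lia.
have k0 : take k V1 != [::] by rewrite -size_eq0 -lt0n size_take; case: ifP => // _; lia.
have eR : reduce (sub V [:: l, m & w]) = U1 ++ take k V1 ++ T.
  rewrite -[RHS]reduce_id; last first.
    apply: reduced_glue => //.
      by apply: (@reduced_catl _ (drop k V1)); rewrite -catA cat_take_drop.
    by apply: (@reduced_catr s); rewrite -eP'; apply: reduce_reduced.
  apply: (_ : _ =F _); rewrite sub_cons -(weq_reduce (sub V (m :: w))) -/P eP' eU.
  by rewrite -catA weq_catKV; reflexivity.
split.
  exists (take k V1 ++ T); rewrite eR /= -sz sU addnK eU take_size_cat //.
move=> _; rewrite eR; have := congr1 size eP'; rewrite !size_cat => sP'.
have : size P + size (V l) = size U1 + (size (take k V1) + size T) + 2 * size s by lia.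
case: (altP (w =P [::])) => [w0|/sP]; last by lia.
have -> : P = V m by rewrite /P w0 sub1 reduce_id.
lia.
Qed.

Lemma small_cancellation_letter w l : reduced w -> sub V w =F [:: l] -> exists x, w = [:: x].
Proof.
case: w => [|x [|y w]] // rw e; first by exists x.
by have [_ /(_ isT)] := small_cancellation rw; rewrite e.
Qed.

End SmallCancellation.

Definition total_size (V : letter -> word) : nat :=
  size (reduce (V (false, false))) + size (reduce (V (true, false))).

Lemma size_reduce_hom V l : hom V -> size (reduce (V (linv l))) = size (reduce (V l)).
Proof. by move=> hV; rewrite (hV l) reduce_winv size_winv. Qed.

Lemma total_sizeE V l m : hom V -> l.1 != m.1 ->
  total_size V = size (reduce (V l)) + size (reduce (V m)).
Proof.
move=> hV; rewrite /total_size.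
have e (x : letter) : size (reduce (V x)) = size (reduce (V (x.1, false))).
  by case: x => [g []] //=; rewrite -(size_reduce_hom _ hV).
by rewrite (e l) (e m); case: l.1; case: m.1 => // _; rewrite addnC.
Qed.

Lemma invertible_nonempty V l : invertible V -> ~ V l =F [::].
Proof.
by case=> W [_ hW _ WV] e; have := WV l; rewrite (weq_sub hW e).
Qed.

(* The tie case of Nielsen reduction: multiplying [V l] by [V m] does not shorten
   it, but becomes [t M t^-1], and conjugating the pair by [t] then does. *)
Lemma half_absorbed V l m n (c := fun x y => cancellation (V x) (V y)) :
  (forall x, reduced (V x)) -> (forall x, V (linv x) = winv (V x)) ->
  (forall x, V x != [::]) ->
  2 * c l m = size (V m) -> 2 * c m n = size (V m) -> l.1 != m.1 -> n.1 != m.1 ->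
  2 * c l m <= size (V l) ->
  exists s M t, [/\ V m = s ++ winv t, V l = t ++ M ++ winv s, size s = size t & n = l].
Proof.
move=> rV iV nV e1 e2 lm nm e3.
have [U1 [s [V1 [eU eV sz _ _]]]] := cancellationP (rV l) (rV m).
have [U2 [t [V2 [eU' eV' sz' _ _]]]] := cancellationP (rV m) (rV n).
rewrite -!/(c _ _) in sz sz'.
have st : size s = size t by lia.
have eVm : V m = s ++ winv t.
  have := congr1 size eU'; rewrite size_cat size_winv => h.
  have := congr1 (take (size s)) eU'; rewrite {1}eV take_size_cat //.
  by rewrite take_size_cat; [move=> ->|lia].
(* In rank 2 both [n] and [l] lie on the one generator other than that of [m]. *)
have [enl | enl] : n = l \/ n = linv l.
  case: l n m lm nm {e1 e2 e3 eU eU' eV eV' eVm sz sz'} => [g e] [g' e'] [g'' e''] /=.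
  move=> lm nm; have -> : g' = g by case: g lm; case: g' nm; case: g''.
  by rewrite /linv /=; case: e; case: e'; [left|right|right|left].
  have [M eM] : exists M, V l = t ++ M ++ winv s.
    exists (take (size U1 - size t) (drop (size t) U1)).
    have h : size t <= size U1 by move: e3; rewrite eU size_cat size_winv; lia.
    have : take (size t) (V l) = t by rewrite -enl eV' take_size_cat.
    rewrite {1}eU takel_cat // => et.
    by rewrite take_oversize ?size_drop // catA -{1}et cat_take_drop.
  by exists s, M, t.
(* If [n = linv l], both halves of [V m] meet the same word, whence [V m = s s^-1] is trivial. *)
case/eqP: (nV m); have : s = t; last by move=> h; apply: weq_reduced => //; rewrite eVm h weq_catV; reflexivity.
have := congr1 (take (size s)) eV'; rewrite enl iV eU winv_cat winvK take_size_cat //.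
by rewrite st take_size_cat.
Qed.

(** The inverse substitution takes letters to letters, hence permutes them; so [V] is a signed
    permutation and the empty walk works. *)
Lemma walkable_letters V : invertible V -> (forall l, reduced (V l)) ->
  (forall w l, reduced w -> sub V w =F [:: l] -> exists x, w = [:: x]) -> walkable V.
Proof.
case=> W [hV hW VW WV] rV short.
have letterW l : exists x, W l =F [:: x].
  have [||x e] := short (reduce (W l)) l; first exact: reduce_reduced.
    by rewrite (weq_sub hV (weq_reduce _)) VW; reflexivity.
  by exists x; rewrite -e weq_reduce; reflexivity.
pose hd u := head (false, false) (reduce u).
pose p l := hd (W l); pose q l := hd (V l).
have eW l : W l =F [:: p l].
  by have [x e] := letterW l; rewrite /p /hd e.
have single x y : [:: x] =F [:: y] -> x = y by case.
have sp : signed p.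
  split=> [l l' e | l].
    by apply: single; rewrite -(VW l) -(VW l'); apply: weq_sub => //; rewrite !eW e; reflexivity.
  by apply: single; rewrite -eW hW eW; reflexivity.
have eV x : V x = [:: q x].
  have e : map p (V x) = [:: x].
    apply: weq_reduced; rewrite ?reduced_map //.
    by rewrite -sub_signed -(WV x); apply: sub_ext => l; rewrite eW; reflexivity.
  rewrite /q /hd reduce_id //.
  by case: (V x) e => [|y [|z v]].
have sq : signed q.
  split=> [l l' e | l].
    by apply: single; rewrite -(WV l) -(WV l') !eV e; reflexivity.
  by apply: single; rewrite -eV hV eV; reflexivity.
exists [::], q; split=> // u; rewrite /= -sub_signed.
by congr (cyclen _); apply: sub_ext => l; rewrite eV; reflexivity.
Qed.

(** Nielsen's induction on the total length of the images: split off a transvection as long as the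
    length can be lowered, after a conjugation if need be; otherwise cancellation is small and the
    images are letters. *)
Theorem invertible_walkable V : invertible V -> walkable V.
Proof.
have [n] := ubnP (total_size V); elim: n V => // n IH V0 tot invV0.
have walk_ext V V' : (forall l, V l =F V' l) -> walkable V' -> walkable V.
  by move=> e; apply: walkable_conj => u; apply/conjw_refl/sub_ext.
pose V l := reduce (V0 l).
apply: (walk_ext _ V) => [l|]; first by rewrite /V weq_reduce; reflexivity.
have invV : invertible V.
  by apply: invertible_ext invV0 => l; rewrite /V weq_reduce; reflexivity.
have hV : hom V by case: invV => W [].
have {tot} tot : total_size V < n.+1.
  by move: tot; rewrite /total_size /V !(reduce_id (reduce_reduced _)).
have rV l : reduced (V l) by apply: reduce_reduced.
have iV l : V (linv l) = winv (V l).
  by rewrite /V -reduce_winv; case: invV0 => W [hV0 _ _ _]; apply: hV0.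
have nV l : V l != [::].
  by apply/eqP => e; apply: (@invertible_nonempty V l invV); rewrite e; reflexivity.
have totV l m : l.1 != m.1 -> total_size V = size (V l) + size (V m).
  by move=> ne; rewrite (total_sizeE hV ne) !reduce_id.
(* Up to conjugation [V] is the shorter [V'] composed with the inverse transvection, so the
   induction hypothesis for [V'] suffices. *)
have step V' l m h : l.1 != m.1 ->
    (forall x, V' x =F winv h ++ sub V (transvection l m x) ++ h) ->
    total_size V' < total_size V -> walkable V.
  move=> ne eV' lt.
  have invV' : invertible V'.
    have := invertible_comp (invertible_inner (winv h))
              (invertible_comp invV (invertible_transvection ne)).
    apply: invertible_ext => x /=.
    by rewrite sub_inner eV' winvK; reflexivity.
  have /(walkable_transvection (_ : l.1 != (linv m).1)) := IH V' (leq_trans lt tot) invV'.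
  move=> /(_ ne); apply: walkable_conj => u.
  apply: (@conjw_sub_ext _ _ h) => x /=.
  have -> : sub V' (transvection l (linv m) x) =F winv h ++ V x ++ h.
    have hh y : V' y =F (sub (inner (winv h)) \o (sub V \o transvection l m)) y.
      by rewrite /= sub_inner eV' winvK; reflexivity.
    rewrite (sub_ext _ hh) -!sub_sub sub_inner winvK.
    by rewrite (weq_sub hV (transvection_inv x ne)) sub1; reflexivity.
  by rewrite -!catA weq_catVK weq_catV cats0; reflexivity.
case: (boolP [exists l : letter, [exists m : letter,
    (l.1 != m.1) && (size (reduce (V l ++ V m)) < size (V l))]]).
  case/existsP=> l /existsP[m /andP[ne lt]].
  apply: (step (sub V \o transvection l m) l m [::]) => // [x|].
    by rewrite /= cats0; reflexivity.
  rewrite (totV l m ne) (total_sizeE _ ne); last exact: hom_comp hV (hom_transvection l m).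
  have [nml nmi] : (m == l) = false /\ (m == linv l) = false.
    by split; apply: contraNF ne => /eqP->.
  by rewrite /= /transvection eqxx nml nmi sub1 sub_cons sub1 (reduce_id (rV m)) ltn_add2r.
rewrite negb_exists => /forallP N1.
have {N1} N1 l m : l.1 != m.1 -> size (V l) <= size (reduce (V l ++ V m)).
  move=> ne; have := N1 l; rewrite negb_exists => /forallP/(_ m).
  by rewrite ne /= -leqNgt.
have N1' l m : l.1 != m.1 -> size (V m) <= size (reduce (V l ++ V m)).
  move=> ne; have := N1 (linv m) (linv l); rewrite /= eq_sym !iV size_winv => /(_ ne).
  by rewrite -winv_cat reduce_winv size_winv.
pose c l m := cancellation (V l) (V m).
have cE l m : size (reduce (V l ++ V m)) + 2 * c l m = size (V l) + size (V m).
  exact: size_reduce_cat.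
have same l m : l.1 = m.1 -> m != linv l -> m = l.
  by case: l m => [g []] [g' []] /= ->; rewrite /linv /= ?eqxx.
have half l m : m != linv l ->
    [/\ 2 * c l m <= size (V l), 2 * c l m <= size (V m)
      & l.1 = m.1 -> 2 * c l m < size (V m)].
  case: (altP (l.1 =P m.1)) => [e /(same _ _ e) -> | ne _].
    by have := cE l l; have := size_square (rV l) (nV l); split; lia.
  by have := cE l m; have := N1 l m ne; have := N1' l m ne; split; lia.
(* The tie case: [V m] is consumed by its two neighbours. Neither takes more than half, so each
   takes exactly half; a neighbour on the same generator would take less, by [size_square]. *)
case: (boolP [exists l : letter, [exists m : letter, [exists n : letter,
    [&& m != linv l, n != linv m & size (V m) <= c l m + c m n]]]]).
  case/existsP=> l /existsP[m /existsP[k /and3P[ml km le]]].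
  have [h1 h2 h3] := half l m ml; have [h4 h5 h6] := half m k km.
  have lm : l.1 != m.1 by apply/eqP => /h3; lia.
  have mk : k.1 != m.1.
    by apply/eqP => e; have em := same m k (esym e) km; move: h5 h6 le; rewrite em => h5 /(_ erefl); lia.
  have [|||||s [M [t [em el st _]]]] := @half_absorbed V l m k rV iV nV => //.
  - by rewrite -/(c _ _); lia.
  - by rewrite -/(c _ _); lia.
  pose V' x := winv t ++ sub V (transvection l m x) ++ t.
  apply: (step V' l m t) => //.
  have hV' : hom V'.
    by move=> x; rewrite /V' (weq_sub hV (hom_transvection _ _ x)) sub_winv // !winv_cat winvK -!catA; reflexivity.
  have [nml nmi] : (m == l) = false /\ (m == linv l) = false.
    by split; apply: contraNF lm => /eqP->.
  have eVl : reduce (V' l) = reduce M.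
    apply: (_ : _ =F _); rewrite /V' /transvection eqxx sub_cons sub1 em el -!catA.
    by rewrite weq_catKV weq_catKV weq_Vcat cats0; reflexivity.
  have eVm : reduce (V' m) = reduce (winv t ++ s).
    apply: (_ : _ =F _); rewrite /V' /transvection nml nmi sub1 em -!catA.
    by rewrite weq_Vcat cats0; reflexivity.
  (* The new total is at most [size M + size s + size t], which is [size (V m)] less than the old
     one. *)
  rewrite (totV l m lm) (total_sizeE hV' lm) eVl eVm.
  have := size_reduce M; have := size_reduce (winv t ++ s).
  have : 0 < size (V m) by rewrite lt0n size_eq0.
  by rewrite em el !size_cat !size_winv; lia.
rewrite negb_exists => /forallP N2.
apply: walkable_letters => // w l rw e.
apply: (@small_cancellation_letter V rV nV _ _ w l rw e) => // [x y /half[]|x y z yx zy] //.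
have := N2 x; rewrite negb_exists => /forallP/(_ y).
by rewrite negb_exists => /forallP/(_ z); rewrite yx zy /= -ltnNge.
Qed.

(** Preimages of the two generators define a right inverse; injectivity makes it two-sided. *)
Lemma is_aut_invertible x y : is_aut x y -> invertible (img x y).
Proof.
case=> inj surj.
have pre (l : letter) : exists w, sub (img x y) w =F [:: l].
  have [|w rw e] := surj [:: l]; first by [].
  by exists w; rewrite /weq -endoE e.
have [wa ea] := pre (false, false); have [wb eb] := pre (true, false).
have VW l : sub (img x y) (img wa wb l) =F [:: l].
  have hi := hom_img x y.
  by case: l => [[] []]; rewrite /img /= ?(sub_winv _ hi) ?ea ?eb; reflexivity.
have hV := hom_img x y; have hW := hom_img wa wb.
exists (img wa wb); split=> // l.
have inj' u v : sub (img x y) u =F sub (img x y) v -> u =F v.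
  move=> e; apply: (inj _ _ (reduce_reduced u) (reduce_reduced v)).
  by rewrite !endoE; apply: (_ : _ =F _); rewrite !(weq_sub hV (weq_reduce _)).
by apply: inj'; rewrite sub_cancel // sub1; reflexivity.
Qed.

Lemma invertible_is_aut V : invertible V -> is_aut (V (false, false)) (V (true, false)).
Proof.
case=> W [hV hW VW WV].
have e w : endo (V (false, false)) (V (true, false)) w = reduce (sub V w).
  by rewrite endoE; apply: (_ : _ =F _); apply: sub_ext => l; apply: hom_imgE.
split=> [w1 w2 r1 r2|w rw].
  rewrite !e => e12; apply: weq_reduced => //.
  by rewrite -(sub_cancel w1 WV) -(sub_cancel w2 WV); apply: weq_sub.
exists (reduce (sub W w)); first exact: reduce_reduced.
rewrite e -[RHS]reduce_id //; apply: (_ : _ =F _).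
by rewrite (weq_sub hV (weq_reduce _)) sub_cancel //; reflexivity.
Qed.

(** * Primitive recursive functions *)

(** Argument lists of every length are allowed, missing arguments reading as 0 as in [ev_proj], so
    no arities are tracked. *)
Definition PR (f : seq nat -> nat) : Prop := exists p, forall xs, eval p xs (f xs).

Notation arg xs i := (nth 0 xs i) (only parsing).

Definition PR1 (f : nat -> nat) := PR (fun xs => f (arg xs 0)).
Definition PR2 (f : nat -> nat -> nat) := PR (fun xs => f (arg xs 0) (arg xs 1)).
Definition PR3 (f : nat -> nat -> nat -> nat) := PR (fun xs => f (arg xs 0) (arg xs 1) (arg xs 2)).
Definition PR5 (f : nat -> nat -> nat -> nat -> nat -> nat) :=
  PR (fun xs => f (arg xs 0) (arg xs 1) (arg xs 2) (arg xs 3) (arg xs 4)).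

Lemma PR_ext f g : f =1 g -> PR f -> PR g.
Proof. by move=> e [p ev]; exists p => xs; rewrite -e. Qed.

Lemma PR_nth i : PR (fun xs => (arg xs i)).
Proof. by exists (PProj i) => xs; constructor. Qed.

Lemma PR_app1 f g : PR1 f -> PR g -> PR (fun xs => f (g xs)).
Proof.
case=> p ep [q eq]; exists (PComp p [:: q]) => xs.
by apply: (@ev_comp _ _ _ [:: g xs]); [do ![constructor] | apply: ep [:: _]].
Qed.

Lemma PR_app2 f g h : PR2 f -> PR g -> PR h -> PR (fun xs => f (g xs) (h xs)).
Proof.
case=> p ep [q eq] [r er]; exists (PComp p [:: q; r]) => xs.
by apply: (@ev_comp _ _ _ [:: g xs; h xs]); [do ![constructor] | apply: ep [:: _; _]].
Qed.

Lemma PR_app3 f g h k : PR3 f -> PR g -> PR h -> PR k ->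
  PR (fun xs => f (g xs) (h xs) (k xs)).
Proof.
case=> p ep [q eq] [r er] [s es]; exists (PComp p [:: q; r; s]) => xs.
apply: (@ev_comp _ _ _ [:: g xs; h xs; k xs]); [do ![constructor] => // | exact: (ep [:: _; _; _])].
Qed.

Lemma PR_const n : PR (fun=> n).
Proof.
elim: n => [|n [p ep]]; first by exists PZero => xs; constructor.
exists (PComp PSucc [:: p]) => xs.
by apply: (@ev_comp _ _ _ [:: n]); [do ![constructor] | apply: (ev_succ [:: n])].
Qed.

Lemma PR_succ : PR1 succn.
Proof. by exists PSucc => xs; case: xs => [|x xs]; apply: ev_succ. Qed.

(** [g] takes its arguments in the order of [ev_recS]: counter, accumulator, parameters. The
    composition supplies the nonempty list that [PRec] needs. *)
Lemma PR_loop f g N A B C : PR3 f -> PR5 g -> PR N -> PR A -> PR B -> PR C ->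
  PR (fun xs => iteri (N xs) (fun k r => g k r (A xs) (B xs) (C xs)) (f (A xs) (B xs) (C xs))).
Proof.
case=> p ep [q eq] [n en] [a ea] [b eb] [c ec].
exists (PComp (PRec p q) [:: n; a; b; c]) => xs.
apply: (@ev_comp _ _ _ [:: N xs; A xs; B xs; C xs]); first by do ![constructor].
elim: (N xs) => [|m IH]; first by constructor; apply: (ep [:: _; _; _]).
by apply: (ev_recS IH); apply: (eq [:: _; _; _; _; _]).
Qed.

Lemma PR_pred : PR1 predn.
Proof.
apply: (PR_ext _ (@PR_loop (fun _ _ _ => 0) (fun k _ _ _ _ => k) _ _ _ _
  (PR_const 0) (PR_nth 0) (PR_nth 0) (PR_const 0) (PR_const 0) (PR_const 0))).
by move=> xs; case: (arg xs 0).
Qed.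

Lemma PR_add : PR2 addn.
Proof.
apply: (PR_ext _ (@PR_loop (fun a _ _ => a) (fun _ r _ _ _ => r.+1) _ _ _ _
  (PR_nth 0) (PR_app1 PR_succ (PR_nth 1)) (PR_nth 0) (PR_nth 1) (PR_const 0) (PR_const 0))).
by move=> xs; elim: (arg xs 0) => //= n ->.
Qed.

Lemma PR_sub : PR2 subn.
Proof.
apply: (PR_ext _ (@PR_loop (fun a _ _ => a) (fun _ r _ _ _ => r.-1) _ _ _ _
  (PR_nth 0) (PR_app1 PR_pred (PR_nth 1)) (PR_nth 1) (PR_nth 0) (PR_const 0) (PR_const 0))).
by move=> xs; elim: (arg xs 1) => /= [|n ->]; rewrite ?subn0 ?subnS.
Qed.

Lemma PR_mul : PR2 muln.
Proof.
apply: (PR_ext _ (@PR_loop (fun _ _ _ => 0) (fun _ r a _ _ => a + r) _ _ _ _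
  (PR_const 0) (PR_app2 PR_add (PR_nth 2) (PR_nth 1)) (PR_nth 0) (PR_nth 1) (PR_const 0) (PR_const 0))).
by move=> xs; elim: (arg xs 0) => //= n ->; rewrite mulSn.
Qed.

Lemma PR_exp5 : PR1 (expn 5).
Proof.
apply: (PR_ext _ (@PR_loop (fun _ _ _ => 1) (fun _ r _ _ _ => 5 * r) _ _ _ _
  (PR_const 1) (PR_app2 PR_mul (PR_const 5) (PR_nth 1)) (PR_nth 0) (PR_const 0) (PR_const 0) (PR_const 0))).
by move=> xs; elim: (arg xs 0) => //= n ->; rewrite expnS.
Qed.

Definition cond (c a b : nat) : nat := if c is 0 then b else a.

Lemma PR_cond : PR3 cond.
Proof.
(* Zero iterations return the third argument, any positive number the second. *)
apply: (PR_ext _ (@PR_loop (fun a _ _ => a) (fun _ _ _ b _ => b) _ _ _ _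
  (PR_nth 0) (PR_nth 3) (PR_nth 0) (PR_nth 2) (PR_nth 1) (PR_const 0))).
by move=> xs; case: (arg xs 0).
Qed.

Definition is_zero (n : nat) : nat := n == 0.

Lemma PR_is_zero : PR1 is_zero.
Proof.
apply: (PR_ext _ (PR_app3 PR_cond (PR_nth 0) (PR_const 0) (PR_const 1))).
by move=> xs; case: (arg xs 0).
Qed.

Definition is_eq (m n : nat) : nat := m == n.

Lemma PR_is_eq : PR2 is_eq.
Proof.
apply: (PR_ext _ (PR_app1 PR_is_zero (PR_app2 PR_add (PR_app2 PR_sub (PR_nth 0) (PR_nth 1))
  (PR_app2 PR_sub (PR_nth 1) (PR_nth 0))))).
by move=> xs; rewrite /is_zero /is_eq; congr nat_of_bool; lia.
Qed.

Lemma PR_table s : PR1 (nth 0 s).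
Proof.
elim: s => [|x s IH].
  by apply: PR_ext (PR_const 0) => xs; rewrite nth_nil.
apply: (PR_ext _ (PR_app3 PR_cond (PR_nth 0) (PR_app1 IH (PR_app1 PR_pred (PR_nth 0))) (PR_const x))).
by move=> xs; case: (arg xs 0).
Qed.

Lemma PR_div5 : PR1 (divn^~ 5).
Proof.
(* The quotient grows from [k] to [k.+1] exactly when [5 * q.+1 <= k.+1]. *)
apply: (PR_ext _ (@PR_loop (fun _ _ _ => 0)
  (fun k q _ _ _ => cond (is_zero (5 * q.+1 - k.+1)) q.+1 q) _ _ _ _
  (PR_const 0) _ (PR_nth 0) (PR_const 0) (PR_const 0) (PR_const 0))).
  move=> xs; elim: (arg xs 0) => //= n ->; rewrite /is_zero.
  by case: eqP => /=; lia.
have sq := PR_app1 PR_succ (PR_nth 1).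
apply: (PR_app3 PR_cond _ sq (PR_nth 1)); apply: (PR_app1 PR_is_zero).
apply: (PR_app2 PR_sub (PR_app2 PR_mul (PR_const 5) sq)); exact: PR_app1 PR_succ (PR_nth 0).
Qed.

Definition digit (n i : nat) : nat := n %/ 5 ^ i %% 5.

Lemma PR_digit : PR2 digit.
Proof.
have shift : PR2 (fun n i => n %/ 5 ^ i).
  apply: (PR_ext _ (@PR_loop (fun a _ _ => a) (fun _ r _ _ _ => r %/ 5) _ _ _ _
    (PR_nth 0) (PR_app1 PR_div5 (PR_nth 1)) (PR_nth 1) (PR_nth 0) (PR_const 0) (PR_const 0))).
  by move=> xs; elim: (arg xs 1) => [|n /= ->]; rewrite ?divn1 // -divnMA -expnSr.
apply: (PR_ext _ (PR_app2 PR_sub shift (PR_app2 PR_mul (PR_app1 PR_div5 shift) (PR_const 5)))).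
by move=> xs; rewrite /digit {1}(divn_eq (_ %/ _) 5) addKn.
Qed.

(** * Computing with words in base 5 *)

(** [n] itself bounds its number of digits. The most significant comes first: the head of a word is
    its lowest digit, and a right fold treats the head last. *)
Definition fold_digits (F : nat -> nat -> nat -> nat) (n z m : nat) : nat :=
  iteri n (fun k r => cond (digit n (n.-1 - k)) (F (digit n (n.-1 - k)) r m) r) z.

Lemma PR_fold_digits F : PR3 F -> PR3 (fold_digits F).
Proof.
move=> pF; have dg := PR_app2 PR_digit (PR_nth 2)
  (PR_app2 PR_sub (PR_app1 PR_pred (PR_nth 2)) (PR_nth 0)).
exact: (@PR_loop (fun _ b _ => b)
  (fun k r a _ c => cond (digit a (a.-1 - k)) (F (digit a (a.-1 - k)) r c) r) _ _ _ _
  (PR_nth 1) (PR_app3 PR_cond dg (PR_app3 pF dg (PR_nth 1) (PR_nth 4)) (PR_nth 1))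
  (PR_nth 0) (PR_nth 0) (PR_nth 1) (PR_nth 2)).
Qed.

Definition code (l : letter) : nat := (enc_letter l).+1.

Definition letter_of (d : nat) : letter := (2 < d, ~~ odd d).

Definition digits (N n : nat) : seq nat := [seq digit n i | i <- iota 0 N].

(* Zero digits are skipped, so that every number codes a word. *)
Definition dec (n : nat) : word := [seq letter_of d | d <- digits n n & d != 0].

Lemma codeK : cancel code letter_of.
Proof. by case=> [[] []]. Qed.

Lemma letter_ofK d : 0 < d < 5 -> code (letter_of d) = d.
Proof. by case: d => [|[|[|[|[|d]]]]]. Qed.

Lemma fold_digitsE F n z m :
  fold_digits F n z m = foldr (fun l r => F (code l) r m) z (dec n).
Proof.
rewrite /fold_digits /dec /digits; set G := fun k r => _.
suffices gen j : j <= n ->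
    iteri j G z = foldr (fun l r => F (code l) r m) z
      [seq letter_of d | d <- [seq digit n i | i <- iota (n - j) j] & d != 0].
  by rewrite gen // subnn.
elim: j => [|j IH] lt //=; rewrite IH 1?ltnW // {1}/G.
have -> : n - j.+1 = n.-1 - j by lia.
have -> : (n.-1 - j).+1 = n - j by lia.
have : digit n (n.-1 - j) < 5 by rewrite ltn_mod.
by case: (digit n (n.-1 - j)) => [|d] //= d5; rewrite letter_ofK.
Qed.

Lemma digitsS N n : digits N.+1 n = n %% 5 :: digits N (n %/ 5).
Proof.
rewrite /digits /= /digit divn1 -(addn0 1) iotaDl -map_comp; congr cons.
by apply: eq_map => i /=; rewrite expnS divnMA.
Qed.

Lemma enc_cons l w : enc (l :: w) = code l + 5 * enc w.
Proof. by []. Qed.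

Lemma code_bounds l : 0 < code l < 5.
Proof. by case: l => [[] []]. Qed.

Lemma enc_modn l w : enc (l :: w) %% 5 = code l.
Proof. by have := code_bounds l; rewrite enc_cons; lia. Qed.

Lemma enc_divn l w : enc (l :: w) %/ 5 = enc w.
Proof. by have := code_bounds l; rewrite enc_cons; lia. Qed.

Lemma size_le_enc w : size w <= enc w.
Proof. by elim: w => // l w IH; rewrite enc_cons /=; have := code_bounds l; lia. Qed.

Lemma enc_lt w : enc w < 5 ^ size w.
Proof. by elim: w => // l w IH; rewrite enc_cons /= expnS; have := code_bounds l; move: (5 ^ size w) IH => B; lia. Qed.

Lemma encK : cancel enc dec.
Proof.
move=> w; rewrite /dec; move: (size_le_enc w); move: {1 2}(enc w) => N.
elim: w N => [|l w IH] N.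
  by move=> _ /=; elim: N => // N IH; rewrite digitsS mod0n div0n.
case: N => // N le; rewrite digitsS enc_modn enc_divn /=.
by rewrite codeK IH.
Qed.

(** The table gives the code of the inverse letter; [d = 0] stands for no letter and pushes
    nothing. *)
Definition push_code (d n : nat) : nat :=
  cond d (cond (is_eq (n %% 5) (nth 0 [:: 0; 2; 1; 4; 3] d)) (n %/ 5) (d + 5 * n)) n.

Arguments push_code : simpl never.

Lemma PR_push_code : PR2 push_code.
Proof.
have dn := PR_app1 PR_div5 (PR_nth 1).
have md : PR (fun xs => (arg xs 1) %% 5).
  apply: (PR_ext _ (PR_app2 PR_digit (PR_nth 1) (PR_const 0))).
  by move=> xs; rewrite /digit divn1.
apply: (PR_app3 PR_cond (PR_nth 0) _ (PR_nth 1)).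
apply: (PR_app3 PR_cond (PR_app2 PR_is_eq md (PR_app1 (PR_table _) (PR_nth 0))) dn).
exact: PR_app2 PR_add (PR_nth 0) (PR_app2 PR_mul (PR_const 5) (PR_nth 1)).
Qed.

Lemma push_codeE l w : push_code (code l) (enc w) = enc (push l w).
Proof.
case: w => [|x w]; first by case: l => [[] []].
rewrite /push_code enc_modn enc_divn /is_eq.
have -> : nth 0 [:: 0; 2; 1; 4; 3] (code l) = code (linv l) by case: l => [[] []].
rewrite (can_eq codeK) /=; case: eqP => // _.
Qed.

Definition swap (l : letter) : letter := (~~ l.1, l.2).

(** The four letters double as names of two stretchings and two generators of the signed
    permutations, so a sequence of moves is itself a word and has a numerical code. *)
Definition move_image (m : letter) (l : letter) : word :=
  if m.1 then [:: if m.2 then swap l else flip true l] else stretch m.2 l.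

(* Entry [5 * m + l] is the code of the first (second) letter of the image of the
   letter coded by [l] under the move coded by [m], or 0 if there is none. *)
Definition move_fst : seq nat :=
  [:: 0; 0; 0; 0; 0;  0; 1; 4; 3; 4;  0; 1; 2; 3; 2;  0; 1; 2; 4; 3;  0; 3; 4; 1; 2].
Definition move_snd : seq nat :=
  [:: 0; 0; 0; 0; 0;  0; 3; 2; 0; 0;  0; 0; 0; 1; 4].

Definition apply_code (d w : nat) : nat :=
  fold_digits (fun l r m => push_code (nth 0 move_fst (5 * m + l))
                            (push_code (nth 0 move_snd (5 * m + l)) r)) w 0 d.

Lemma PR_apply_code : PR2 apply_code.
Proof.
have idx := PR_app2 PR_add (PR_app2 PR_mul (PR_const 5) (PR_nth 2)) (PR_nth 0).
have step : PR3 (fun l r m => push_code (nth 0 move_fst (5 * m + l))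
    (push_code (nth 0 move_snd (5 * m + l)) r)).
  exact: PR_app2 PR_push_code (PR_app1 (PR_table move_fst) idx)
    (PR_app2 PR_push_code (PR_app1 (PR_table move_snd) idx) (PR_nth 1)).
exact: PR_app3 (PR_fold_digits step) (PR_nth 1) (PR_const 0) (PR_nth 0).
Qed.

Lemma reduce_sub f w :
  reduce (sub f w) = foldr (fun l r => foldr push r (f l)) [::] w.
Proof. by elim: w => //= l w IH; rewrite sub_cons reduce_cat IH. Qed.

Lemma apply_codeE m w : apply_code (code m) (enc w) = enc (reduce (sub (move_image m) w)).
Proof.
rewrite /apply_code fold_digitsE encK reduce_sub.
elim: w => //= l w ->; move: (foldr _ [::] w) => r.
have e0 n : push_code 0 n = n by [].
by case: m => [[] []]; case: l => [[] []] /=; rewrite ?e0 -?push_codeE.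
Qed.

Definition run (ms w : word) : word :=
  foldr (fun m r => reduce (sub (move_image m) r)) w ms.

Definition run_code (n w : nat) : nat := fold_digits (fun d r _ => apply_code d r) n w 0.

Lemma PR_run_code : PR2 run_code.
Proof.
have step : PR3 (fun d r _ => apply_code d r) := PR_app2 PR_apply_code (PR_nth 0) (PR_nth 1).
exact: PR_app3 (PR_fold_digits step) (PR_nth 0) (PR_nth 1) (PR_const 0).
Qed.

Lemma run_codeE n w : run_code n (enc w) = enc (run (dec n) w).
Proof. by rewrite /run_code fold_digitsE /run; elim: (dec n) => //= m ms ->; rewrite apply_codeE. Qed.

Definition size_code (n : nat) : nat := fold_digits (fun _ r _ => r.+1) n 0 0.

Lemma PR_size_code : PR1 size_code.
Proof.
have step : PR3 (fun _ r _ => r.+1) := PR_app1 PR_succ (PR_nth 1).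
exact: PR_app3 (PR_fold_digits step) (PR_nth 0) (PR_const 0) (PR_const 0).
Qed.

Lemma size_codeE w : size_code (enc w) = size w.
Proof. by rewrite /size_code fold_digitsE encK; elim: w => //= l w ->. Qed.

(** The formula of [cyclen_square]: pushing the letters of a reduced word onto the word itself
    reduces its square. *)
Definition cyclen_code (n : nat) : nat :=
  size_code (fold_digits (fun d r _ => push_code d r) n n 0) - size_code n.

Lemma PR_cyclen_code : PR1 cyclen_code.
Proof.
apply: (PR_app2 PR_sub _ (PR_app1 PR_size_code (PR_nth 0))).
apply: (PR_app1 PR_size_code).
have step : PR3 (fun d r _ => push_code d r) := PR_app2 PR_push_code (PR_nth 0) (PR_nth 1).
exact: PR_app3 (PR_fold_digits step) (PR_nth 0) (PR_nth 0) (PR_const 0).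
Qed.

Lemma cyclen_codeE w : reduced w -> cyclen_code (enc w) = cyclen w.
Proof.
move=> rw; rewrite cyclen_square // /cyclen_code size_codeE fold_digitsE encK.
rewrite reduce_cat (reduce_id rw) -[size (foldr _ _ _)]size_codeE; congr (size_code _ - _).
by elim: {2 4}w => //= l v IH; rewrite -push_codeE -IH.
Qed.

Definition test (u v n : nat) : bool :=
  cyclen_code (run_code n u) == cyclen_code (run_code n v).

(** At most [3 * (size u + size v) + 1] stretchings and 4 moves for the signed permutation are
    needed; codes of words bound their sizes, and a word of [k] moves has code below [5 ^ k]. *)
Definition bound (u v : nat) : nat := 5 ^ (3 * (u + v) + 5).

Definition decide (u v : nat) : bool := all (test u v) (iota 0 (bound u v)).

Lemma PR_decide : PR2 (fun u v => decide u v).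
Proof.
have cl i : PR (fun xs => cyclen_code (run_code (arg xs 0) (arg xs i))).
  exact: PR_app1 PR_cyclen_code (PR_app2 PR_run_code (PR_nth 0) (PR_nth i)).
have bd : PR2 bound.
  apply: (PR_app1 PR_exp5); apply: (PR_app2 PR_add _ (PR_const 5)).
  exact: PR_app2 PR_mul (PR_const 3) (PR_app2 PR_add (PR_nth 0) (PR_nth 1)).
apply: (PR_ext _ (@PR_loop (fun _ _ _ => 1) (fun n r u v _ => r * test u v n) _ _ _ _
  (PR_const 1) (PR_app2 PR_mul (PR_nth 1) (PR_app2 PR_is_eq (cl 2) (cl 3)))
  bd (PR_nth 0) (PR_nth 1) (PR_const 0))).
move=> xs; rewrite /decide; elim: (bound _ _) => // n IH.
by rewrite -addn1 iotaD all_cat addn1 /= IH andbT; case: all; case: test.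
Qed.

(** * Correctness *)

Lemma invertible_signed p : involutive p -> signed p -> invertible (fun l => [:: p l]).
Proof.
by move=> ip sp; exists (fun l => [:: p l]); split; try exact: hom_signed;
  move=> l; rewrite sub1 ip; reflexivity.
Qed.

Lemma signed_swap : signed swap.
Proof. by split=> [[[] []] [[] []]|[[] []]]. Qed.

Lemma invertible_move m : invertible (move_image m).
Proof.
case: m => [[] []]; rewrite /move_image /=.
- by apply: (invertible_signed _ signed_swap) => [[[] []]].
- by apply: (invertible_signed _ (signed_flip true)) => [[[] []]].
- apply: (invertible_ext _ (@invertible_transvection (true, false) (false, false) isT)).
  by case=> [[] []].
- apply: (invertible_ext _ (@invertible_transvection (false, false) (true, false) isT)).
  by case=> [[] []].
Qed.

Lemma run_invertible ms : exists V, invertible V /\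
  forall w, reduced w -> run ms w = reduce (sub V w).
Proof.
elim: ms => [|m ms [V [invV e]]].
  exists (fun l => [:: l]); split=> [|w rw]; first exact: (invertible_signed _ signed_id).
  by rewrite sub_id reduce_id.
exists (sub (move_image m) \o V); split=> [|w rw].
  exact: invertible_comp (invertible_move m) invV.
have [W [hm _ _ _]] := invertible_move m.
by rewrite /= e // -sub_sub; apply: weq_sub hm (weq_reduce _).
Qed.

Lemma reduced_run ms w : reduced w -> reduced (run ms w).
Proof. by case: ms => //= m ms _; apply: reduce_reduced. Qed.

Lemma run_cat ms ns w : run (ms ++ ns) w = run ms (run ns w).
Proof. exact: foldr_cat. Qed.

Lemma run_stretch_walk p w w' : w =F w' ->
  run (rev (map (pair false) p)) w =F stretch_walk p w'.
Proof.
elim: p w w' => //= g p IH w w' e; rewrite rev_cons -cats1 run_cat; apply: IH.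
by rewrite /= weq_reduce; apply: weq_sub e; apply: hom_stretch.
Qed.

(** The values at the two generators leave eight signed permutations, each written out as a product
    of swaps [S] and flips [F]. *)
Lemma signed_run q : signed q -> exists ms, size ms <= 4 /\
  forall w, run ms w =F map q w.
Proof.
move=> [iq sq]; pose F : letter := (true, false); pose S : letter := (true, true).
pose perm (m : letter) := if m.2 then swap else flip true.
have runE ms w : all (fun m => m.1) ms -> run ms w =F map (fun l => foldr perm l ms) w.
  elim: ms => [_|m ms IH /= /andP[m1 /IH e]]; first by rewrite map_id; reflexivity.
  have [W [hm _ _ _]] := invertible_move m.
  rewrite weq_reduce (weq_sub hm e) /move_image m1 sub_letters -sub_signed.
  by apply: sub_ext => l; rewrite /= /perm; case: ifP; reflexivity.
suffices [ms [sz am e]] : exists ms, [/\ size ms <= 4, all (fun m => m.1) ms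
    & forall l, foldr perm l ms = q l].
  exists ms; split=> // w; rewrite (runE _ _ am).
  by rewrite (eq_map e); reflexivity.
have ends ms : foldr perm (false, false) ms = q (false, false) ->
    foldr perm (true, false) ms = q (true, false) ->
    forall l, foldr perm l ms = q l.
  have sp : signed (fun l => foldr perm l ms).
    elim: ms => [|m ms IH]; first exact: signed_id.
    by apply: (signed_comp _ IH); rewrite /perm; case: m.2; [apply: signed_swap | apply: signed_flip].
  move=> ea eb [[] []] //=; first by rewrite -[(true, true)]/(linv (true, false)) sp.2 sq eb.
  by rewrite -[(false, true)]/(linv (false, false)) sp.2 sq ea.
have ne : (q (false, false)).1 != (q (true, false)).1.
  apply/eqP => e.
  have : q (false, false) = q (true, false) \/ q (false, false) = q (linv (true, false)).
    by rewrite sq; case: (q _) (q _) e => [g []] [g' []] /= ->; [left|right|right|left].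
  by case=> /iq.
case ea: (q (false, false)) ne => [g e]; case eb: (q (true, false)) => [g' e'] /=.
case: g ea; case: g' eb => //; case: e; case: e' => eb ea _.
- by exists [:: F; S; F]; split=> //; apply: ends; rewrite ?ea ?eb.
- by exists [:: F; S]; split=> //; apply: ends; rewrite ?ea ?eb.
- by exists [:: S; F]; split=> //; apply: ends; rewrite ?ea ?eb.
- by exists [:: S]; split=> //; apply: ends; rewrite ?ea ?eb.
- by exists [:: F; S; F; S]; split=> //; apply: ends; rewrite ?ea ?eb.
- by exists [:: S; F; S]; split=> //; apply: ends; rewrite ?ea ?eb.
- by exists [:: F]; split=> //; apply: ends; rewrite ?ea ?eb.
- by exists [::]; split=> //; apply: ends; rewrite ?ea ?eb.
Qed.

Lemma testE u v n : reduced u -> reduced v ->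
  test (enc u) (enc v) n = (cyclen (run (dec n) u) == cyclen (run (dec n) v)).
Proof. by move=> ru rv; rewrite /test !run_codeE !cyclen_codeE ?reduced_run. Qed.

Lemma size_cyc_reduce w : reduced w -> size (cyc_reduce w) <= size w.
Proof.
by case/cyc_reduce_spec=> g [e _]; rewrite [X in _ <= size X]e !size_cat; lia.
Qed.

(** Every tested sequence of moves is an automorphism. Conversely any automorphism acts on cyclic
    lengths as a signed permutation and a walk, and short walks, all of them tested, determine the
    sizes along every walk. *)
Lemma decideP u v : reduced u -> reduced v ->
  decide (enc u) (enc v) <-> translation_equivalent u v.
Proof.
move=> ru rv; split=> [/allP dec_uv x y aut | te]; last first.
  apply/allP => n _; rewrite testE //.
  have [V [invV e]] := run_invertible (dec n).
  have := te _ _ (invertible_is_aut invV); rewrite !endoE !e //.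
  have hV : hom V by case: invV => W [].
  have im w : sub (img (V (false, false)) (V (true, false))) w =F sub V w.
    by apply: sub_ext => l; apply: hom_imgE.
  by rewrite !im => ->.
have [p [q [sq e]]] := invertible_walkable (is_aut_invertible aut).
rewrite !endoE !e.
have [uc cu] := conjw_cyc_reduce ru; have [vc cv] := conjw_cyc_reduce rv.
have rep w c r : conjw w c -> cyc c ->
    cyclen (reduce (stretch_walk r (map q w))) = size (walk r (map q c)).
  by move=> wc cc; apply: cyclen_stretch_walk; rewrite ?map_cyc //; apply: conjw_map.
rewrite (rep _ _ p uc cu) (rep _ _ p vc cv).
apply: (@short_walks_determine_sizes (3 * (size u + size v))) => [|r le_r].
  have := potential_le (map q (cyc_reduce u)); have := potential_le (map q (cyc_reduce v)).
  by have := size_cyc_reduce ru; have := size_cyc_reduce rv; rewrite !size_map; lia.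
rewrite -(rep _ _ r uc cu) -(rep _ _ r vc cv).
have [ms [sz ems]] := signed_run sq.
(* [run] applies the last move of its list first, so the signed permutation stands last and the walk
   is reversed. *)
pose path := rev (map (pair false) r) ++ ms.
have pathE w : reduced w -> reduce (stretch_walk r (map q w)) = run path w.
  move=> rw; rewrite -[RHS]reduce_id ?reduced_run //.
  by rewrite /path run_cat; apply/esym/run_stretch_walk/ems.
rewrite !pathE //; apply/eqP; rewrite -(encK path) -testE //; apply: dec_uv.
rewrite mem_iota /= add0n; apply: leq_trans (enc_lt path) _.
rewrite leq_exp2l // /path size_cat size_rev size_map.
by have := size_le_enc u; have := size_le_enc v; lia.
Qed.

Theorem theorem1p2 :
  exists p : prf, forall u v : seq letter, reduced u -> reduced v ->
    exists b : bool, eval p [:: enc u; enc v] (nat_of_bool b) /\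
      (b = true <-> translation_equivalent u v).
Proof.
have [p ev] := PR_decide; exists p => u v ru rv.
by exists (decide (enc u) (enc v)); split; [apply: (ev [:: _; _]) | apply: decideP].
Qed.
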